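(* Let $f$ be an octonion-valued slice regular function on $\mathbb B=\{w\in\mathbb O:|w|<1\}$ such that $\widetilde d\big(f(\mathbb B)\big)=2$, where $\widetilde d$ denotes the regular diameter. Then $$\widetilde d\big(f(r\mathbb B)\big)\leq 2r\qquad\text{for each } r\in(0,1), \tag{a}$$ and $$|f'(0)|\leq 1. \tag{b}$$ Moreover, equality holds in (a) for some $r_0\in(0,1)$, or in (b), if and only if $f$ is an affine function $f(w)=f(0)+wf'(0)$.
   Context: $\mathbb O$ is the real division algebra of octonions, with norm $|w|$. $\mathbb S=\{w\in\mathbb O:w^2=-1\}$; for $I\in\mathbb S$, $\mathbb C_I=\mathbb R\oplus I\mathbb R$ and $\Omega_I=\Omega\cap\mathbb C_I$. $f:\Omega\to\mathbb O$ on a domain $\Omega\subseteq\mathbb O$ is slice regular if for every $I\in\mathbb S$ its restriction $f_I$ to $\Omega_I$ has continuous partial derivatives and $\frac12(\frac{\partial}{\partial x}+I\frac{\partial}{\partial y})f_I(x+yI)=0$ on $\Omega_I$. The slice derivative is $f'(x+yI)=\frac12(\frac{\partial}{\partial x}-I\frac{\partial}{\partial y})f_I(x+yI)$. Slice regular functions on $\mathbb B$ are exactly the convergent power series $f(w)=\sum_{n\ge0} w^na_n$, $a_n\in\mathbb O$; here $f'(0)=a_1$. Regular diameter: for $f(w)=\sum_{n\ge0}w^na_n$ on $\mathbb B$ and $u\in\overline{\mathbb B}$, put $f_u(w)=\sum_{n\ge 0}w^n(u^na_n)$. For $r\in(0,1)$, $$\widetilde d\big(f(r\mathbb B)\big)=\max_{u,v\in\overline{\mathbb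 B}}\ \max_{|w|\le r}|f_u(w)-f_v(w)|,$$ and $\widetilde d\big(f(\mathbb B)\big)=\lim_{r\to1^-}\widetilde d\big(f(r\mathbb B)\big)$. *)

(* Defs.v *)
From Stdlib Require Import Reals ClassicalEpsilon.
From Coquelicot Require Import Coquelicot.
Open Scope R_scope.

(** * Octonions, by Cayley-Dickson doubling from Coquelicot's complex numbers *)

(* The base pairs are written [R * R] rather than [C] so that the instances
   found on [oct] are the product instances over [R_AbsRing] (not [C_AbsRing]).
   Coquelicot's product norm is [sqrt (|x|^2 + |y|^2)], so [norm] on [oct] is
   the Euclidean norm of R^8, and [plus], [minus], [scal] and the topology are
   those of R^8. *)
Definition quat : Type := ((R * R) * (R * R))%type.
Definition oct : Type := (quat * quat)%type.

Definition qconj (p : quat) : quat := (Cconj (fst p), Copp (snd p)).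

Definition qmul (p q : quat) : quat :=
  (Cminus (Cmult (fst p) (fst q)) (Cmult (Cconj (snd q)) (snd p)),
   Cplus (Cmult (snd q) (fst p)) (Cmult (snd p) (Cconj (fst q)))).

Definition omul (p q : oct) : oct :=
  (minus (qmul (fst p) (fst q)) (qmul (qconj (snd q)) (snd p)),
   plus (qmul (snd q) (fst p)) (qmul (snd p) (qconj (fst q)))).

Definition ozero : oct := zero.

Definition oreal (x : R) : oct := (((x, 0), (0, 0)), ((0, 0), (0, 0))).

Definition ounit_i : oct := (((0, 1), (0, 0)), ((0, 0), (0, 0))).

Definition ore (w : oct) : R := fst (fst (fst w)).

Definition oim (w : oct) : oct := minus w (oreal (ore w)).

Fixpoint opow (w : oct) (n : nat) : oct :=
  match n with
  | 0%nat => oreal 1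
  | S m => omul w (opow w m)
  end.

Definition oball (w : oct) : Prop := norm w < 1.

(** * Slice regular functions *)

Definition imag_unit (I : oct) : Prop := omul I I = oreal (-1).

Definition slice_pt (I : oct) (x y : R) : oct := plus (oreal x) (scal y I).

(* The derivative of a curve; meaningful where [g] is differentiable. *)
Definition oct_derive (g : R -> oct) (t : R) : oct :=
  epsilon (inhabits ozero) (fun l => is_derive g t l).

Definition slice_dx (f : oct -> oct) (I : oct) (x y : R) : oct :=
  oct_derive (fun t => f (slice_pt I t y)) x.

Definition slice_dy (f : oct -> oct) (I : oct) (x y : R) : oct :=
  oct_derive (fun t => f (slice_pt I x t)) y.

(* Functions on a domain [Omega] are total functions whose values outside
   [Omega] are irrelevant; [Omega] is meant to be open. *)
Definition slice_regular (Omega : oct -> Prop) (f : oct -> oct) : Prop :=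
  forall I : oct, imag_unit I ->
  forall x y : R, Omega (slice_pt I x y) ->
    ex_derive (fun t => f (slice_pt I t y)) x /\
    ex_derive (fun t => f (slice_pt I x t)) y /\
    continuous (fun p : R * R => slice_dx f I (fst p) (snd p)) (x, y) /\
    continuous (fun p : R * R => slice_dy f I (fst p) (snd p)) (x, y) /\
    scal (1 / 2) (plus (slice_dx f I x y) (omul I (slice_dy f I x y))) = ozero.

(* [w = ore w + norm (oim w) * slice_unit w]; a real [w] lies on every slice
   and [ounit_i] is an arbitrary choice, which does not affect [slice_derive]
   when [f] is slice regular. *)
Definition slice_unit (w : oct) : oct :=
  if excluded_middle_informative (oim w = ozero) then ounit_i
  else scal (/ norm (oim w)) (oim w).

Definition slice_derive (f : oct -> oct) (w : oct) : oct :=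
  let I := slice_unit w in
  let x := ore w in
  let y := norm (oim w) in
  scal (1 / 2) (minus (slice_dx f I x y) (omul I (slice_dy f I x y))).

(** * Regular diameter *)

Definition oct_series (a : nat -> oct) : oct :=
  epsilon (inhabits ozero) (fun l => is_series a l).

Definition power_expansion (f : oct -> oct) (a : nat -> oct) : Prop :=
  forall w : oct, oball w -> is_series (fun n => omul (opow w n) (a n)) (f w).

(* The coefficients of the expansion on the unit ball, which exist and are
   unique when [f] is slice regular there. *)
Definition coeff (f : oct -> oct) : nat -> oct :=
  epsilon (inhabits (fun _ : nat => ozero)) (power_expansion f).

Definition f_sub (f : oct -> oct) (u w : oct) : oct :=
  oct_series (fun n => omul (opow w n) (omul (opow u n) (coeff f n))).

(* For [r] in (0,1) and [f] slice regular on the unit ball, the set is bounded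
   and the supremum is a maximum: the difference is continuous in [(u, v, w)]
   on a compact set. *)
Definition regular_diam (f : oct -> oct) (r : R) : R :=
  real (Lub_Rbar (fun d : R =>
    exists u v w : oct,
      norm u <= 1 /\ norm v <= 1 /\ norm w <= r /\
      d = norm (minus (f_sub f u w) (f_sub f v w)))).

Definition is_regular_diam_ball (f : oct -> oct) (d : Rbar) : Prop :=
  filterlim (regular_diam f) (at_left 1) (Rbar_locally d).

(* Main.v *)
Require Import Defs.
From Stdlib Require Import Reals ZArith Lra Lia ClassicalEpsilon.
From Coquelicot Require Import Coquelicot.
Open Scope R_scope.

(* For unit-ball octonions u, v, the function g = f_u - f_v has the expansion
   sum w^n b_n with b_n = (u^n - v^n) a_n, so b_0 = 0, and |g| <= 2 on the ball. On the
   slice of an imaginary unit I, w = s exp(I x), and for a unit octonion e the number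
   <w^-1 g(w), e> is a harmonic function of (s, x), with coefficients <b_(n+1), e> and
   <I b_(n+1), e>; this uses only that left multiplication by I is a skew isometry of
   R^8 with square -1. The function is at most 2 / s, hence the coefficient estimate for
   nonnegative harmonic functions and Harnack's inequality apply to 2 - <w^-1 g(w), e>.

   With u = 1, v = -1 and e along a_1 this gives |a_1| <= 1. Harnack's inequality with e
   along w^-1 g(w) gives |g(w)| <= |w| (2 - 2 (1 - |a_1|) (1 - |w|) / (1 + |w|)), whence
   (a), with equality only if |a_1| = 1.

   If |a_1| = 1, take e = a_1, u = exp(I t) and v = -exp(-I t): then <b_1, e> = 2 cos t,
   so <b_n, e> and <I b_n, e> are O(t^2), while b_n is 2 cos(nt) a_n or
   2 sin(nt) I a_n. As t tends to 0 this shows <a_n, a_1> = <I a_n, a_1> = 0 for n >= 2.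
   On one slice this does not suffice (only a complex line is excluded), but I is
   arbitrary, so <c a_n, a_1> = 0 for every octonion c, and a_n = 0.

   The power expansion of f comes from Cauchy's formula on each slice, proved by
   contracting the circle to the point; the real axis, common to all slices, shows that
   the coefficients do not depend on the slice. *)

(* The library lemmas leave equations between reals at the carrier of some
   structure on [R], where [ring] and [field] do not recognize them. *)
Ltac real_eq := match goal with |- ?u = ?v => change (@eq R u v) end.

(** * Octonion algebra *)

Definition oip (p q : oct) : R :=
  let '(((p0, p1), (p2, p3)), ((p4, p5), (p6, p7))) := p in
  let '(((q0, q1), (q2, q3)), ((q4, q5), (q6, q7))) := q in
  p0 * q0 + p1 * q1 + p2 * q2 + p3 * q3 + p4 * q4 + p5 * q5 + p6 * q6 + p7 * q7.

Ltac oct_case :=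
  repeat match goal with
  | p : oct |- _ => destruct p as [[[? ?] [? ?]] [[? ?] [? ?]]]
  end.

(** Identities become polynomial identities in the real coordinates. Only variables of type [oct]
    are split, so opaque terms such as [a 1%nat] are generalized before the call. *)
Ltac oct_ring :=
  intros; oct_case; cbv -[Rplus Rmult Ropp Rminus Rinv IZR];
  repeat match goal with |- (_, _) = (_, _) => apply (f_equal2 (@pair _ _)) end;
  real_eq; ring.

(** Left alternativity stands in for associativity: for an imaginary unit p it makes left
    multiplication by p square to -1. *)
Lemma omul_alt (p q : oct) : omul p (omul p q) = omul (omul p p) q.
Proof. oct_ring. Qed.

(** [minus (oreal (2 * ore x)) x] is the conjugate of x. This form of right alternativity cancels x
    at the end of the extremal case. *)
Lemma omul_conj_mul (a x : oct) :
  omul (omul a (minus (oreal (2 * ore x)) x)) x = scal (oip x x) a.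
Proof. oct_ring. Qed.

(** Degen's eight-square identity, the source of the multiplicativity of the norm. *)
Lemma oip_omul (p q : oct) : oip (omul p q) (omul p q) = oip p p * oip q q.
Proof. oct_ring. Qed.

Lemma omul_plus_r (p q r : oct) : omul p (plus q r) = plus (omul p q) (omul p r).
Proof. oct_ring. Qed.

Lemma omul_minus_r (p q r : oct) : omul p (minus q r) = minus (omul p q) (omul p r).
Proof. oct_ring. Qed.

Lemma omul_scal_r (c : R) (p q : oct) : omul p (scal c q) = scal c (omul p q).
Proof. oct_ring. Qed.

Lemma omul_slice (I p : oct) (x y : R) :
  omul (slice_pt I x y) p = plus (scal x p) (scal y (omul I p)).
Proof. oct_ring. Qed.

Lemma omul_real_l (x : R) (p : oct) : omul (oreal x) p = scal x p.
Proof. oct_ring. Qed.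

Lemma omul_zero_r (p : oct) : omul p ozero = ozero.
Proof. oct_ring. Qed.

Lemma oip_plus_l (p q e : oct) : oip (plus p q) e = oip p e + oip q e.
Proof. oct_ring. Qed.

Lemma oip_minus_l (p q e : oct) : oip (minus p q) e = oip p e - oip q e.
Proof. oct_ring. Qed.

Lemma oip_opp_l (p e : oct) : oip (opp p) e = - oip p e.
Proof. oct_ring. Qed.

Lemma oip_scal_l (c : R) (p e : oct) : oip (scal c p) e = c * oip p e.
Proof. oct_ring. Qed.

Lemma oip_sym (p q : oct) : oip p q = oip q p.
Proof. oct_ring. Qed.

Lemma oip_zero_l (e : oct) : oip ozero e = 0.
Proof. oct_ring. Qed.

Lemma oip_ge_0 (p : oct) : 0 <= oip p p.
Proof. oct_case; cbv -[Rplus Rmult Rle IZR]; nra. Qed.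

Lemma oip_eq_0 (p : oct) : oip p p = 0 -> p = ozero.
Proof.
oct_case; cbv -[Rplus Rmult IZR]; intros H.
repeat apply (f_equal2 (@pair _ _)); nra.
Qed.

Lemma oip_ext (p q : oct) : (forall e, oip p e = oip q e) -> p = q.
Proof.
intros H.
assert (E : minus p q = ozero)
  by (apply oip_eq_0; rewrite oip_minus_l, H; ring).
transitivity (plus (minus p q) q); [oct_ring|].
rewrite E; oct_ring.
Qed.

Lemma norm_oip (p : oct) : norm p = sqrt (oip p p).
Proof.
(* The product norm nests three levels of pairs; the squared square roots of the inner levels
   cancel. *)
oct_case; cbn -[pow]; unfold prod_norm, norm; cbn -[pow]; unfold prod_norm, norm; cbn -[pow]; unfold prod_norm, norm; cbn -[pow]; unfold abs; cbn -[pow].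
repeat rewrite pow2_sqrt by (repeat apply Rplus_le_le_0_compat; apply pow2_ge_0).
f_equal. rewrite <- !Rsqr_pow2, <- !Rsqr_abs. unfold Rsqr. ring.
Qed.

Lemma norm_oip_sqr (p : oct) : norm p * norm p = oip p p.
Proof. rewrite norm_oip; apply sqrt_def, oip_ge_0. Qed.

Lemma norm_omul (p q : oct) : norm (omul p q) = norm p * norm q.
Proof. rewrite !norm_oip, oip_omul; apply sqrt_mult; apply oip_ge_0. Qed.

Lemma onorm_scal (c : R) (p : oct) : norm (scal c p) = Rabs c * norm p.
Proof.
rewrite !norm_oip, oip_scal_l, oip_sym, oip_scal_l, <- Rmult_assoc.
rewrite sqrt_mult; [|apply Rle_0_sqr|apply oip_ge_0].
f_equal; apply sqrt_Rsqr_abs.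
Qed.

Lemma norm_oreal (x : R) : norm (oreal x) = Rabs x.
Proof.
rewrite norm_oip; replace (oip _ _) with (Rsqr x) by oct_ring.
apply sqrt_Rsqr_abs.
Qed.

(** Cauchy-Schwarz from the multiplicative norm: <p, q> is the real part of conj(q) p, whose norm is
    |q| |p|. *)
Lemma oip_le_norm (p q : oct) : Rabs (oip p q) <= norm p * norm q.
Proof.
set (c := minus (oreal (2 * ore q)) q).
assert (E : oip p q = ore (omul c p)) by (unfold c; oct_ring).
assert (N : oip c c = oip q q) by (unfold c; oct_ring).
assert (L : forall x : oct, ore x * ore x <= oip x x)
  by (intros x; oct_case; cbv -[Rplus Rmult Rle IZR]; nra).
rewrite !norm_oip, <- sqrt_mult by apply oip_ge_0.
rewrite E, Rmult_comm, <- N, <- oip_omul, <- sqrt_Rsqr_abs.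
apply sqrt_le_1_alt, L.
Qed.

Lemma is_linear_oip (e : oct) : is_linear (fun p : oct => oip p e).
Proof.
split.
- intros x y; apply oip_plus_l.
- intros k x; apply oip_scal_l.
(* [is_linear] asks for a positive bound, and e may be 0. *)
- exists (norm e + 1). split.
  + pose proof (norm_ge_0 e); lra.
  + intros x. apply Rle_trans with (norm x * norm e); [apply oip_le_norm|].
    pose proof (norm_ge_0 x). nra.
Qed.

Lemma is_series_oip (a : nat -> oct) (l e : oct) :
  is_series a l -> is_series (fun n => oip (a n) e) (oip l e).
Proof.
intros H.
assert (S : forall n, sum_n (fun k => oip (a k) e) n = oip (sum_n a n) e).
{ induction n as [|n IH]; [now rewrite !sum_O|].
  rewrite !sum_Sn, IH; symmetry; apply oip_plus_l. }
unfold is_series.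
apply filterlim_ext with (fun n => oip (sum_n a n) e); [now intros n|].
apply (filterlim_comp _ _ _ _ (fun p => oip p e) _ _ _ H).
apply (linear_cont (fun p : oct => oip p e)), is_linear_oip.
Qed.

Lemma is_derive_oip (g : R -> oct) (t : R) (l e : oct) :
  is_derive g t l -> is_derive (fun x => oip (g x) e) t (oip l e).
Proof.
intros H.
assert (F := filterdiff_comp' g (fun p : oct => oip p e) t _ _ H
  (filterdiff_linear _ (is_linear_oip e))).
apply (filterdiff_ext_lin _ _ _ F).
intros y; apply oip_scal_l.
Qed.

Lemma is_series_pair {U V : NormedModule R_AbsRing} (a : nat -> U * V) (l : U * V) :
  is_series (fun n => fst (a n)) (fst l) -> is_series (fun n => snd (a n)) (snd l) ->
  is_series a l.
Proof.
intros H1 H2.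
assert (S : forall n, sum_n a n =
  (sum_n (fun k => fst (a k)) n, sum_n (fun k => snd (a k)) n)).
{ induction n as [|n IH]; [rewrite !sum_O; now destruct (a 0%nat)|].
  rewrite !sum_Sn, IH; reflexivity. }
apply filterlim_locally; intros eps.
generalize (filter_and _ _ (proj1 (filterlim_locally _ _) H1 eps)
  (proj1 (filterlim_locally _ _) H2 eps)); apply filter_imp.
intros n [A B]; rewrite S; now split.
Qed.

(** Testing against all e reduces octonion series to real ones: the eight coordinates are the inner
    products with the basis vectors. *)
Lemma is_series_oct (a : nat -> oct) (l : oct) :
  (forall e, is_series (fun n => oip (a n) e) (oip l e)) -> is_series a l.
Proof.
intros H.
assert (P : forall (c : oct -> R) (e : oct), (forall p, oip p e = c p) ->
  is_series (fun n => c (a n)) (c l)).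
{ intros c e E. rewrite <- E.
  apply (is_series_ext (fun n => oip (a n) e)); [intros n; apply E|apply H]. }
repeat apply is_series_pair.
- apply (P (fun p => fst (fst (fst p))) (((1, 0), (0, 0)), ((0, 0), (0, 0)))); oct_ring.
- apply (P (fun p => snd (fst (fst p))) (((0, 1), (0, 0)), ((0, 0), (0, 0)))); oct_ring.
- apply (P (fun p => fst (snd (fst p))) (((0, 0), (1, 0)), ((0, 0), (0, 0)))); oct_ring.
- apply (P (fun p => snd (snd (fst p))) (((0, 0), (0, 1)), ((0, 0), (0, 0)))); oct_ring.
- apply (P (fun p => fst (fst (snd p))) (((0, 0), (0, 0)), ((1, 0), (0, 0)))); oct_ring.
- apply (P (fun p => snd (fst (snd p))) (((0, 0), (0, 0)), ((0, 1), (0, 0)))); oct_ring.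
- apply (P (fun p => fst (snd (snd p))) (((0, 0), (0, 0)), ((0, 0), (1, 0)))); oct_ring.
- apply (P (fun p => snd (snd (snd p))) (((0, 0), (0, 0)), ((0, 0), (0, 1)))); oct_ring.
Qed.

(** * Trigonometric polynomials and Harnack's inequality *)

Lemma sin_period_Z (k : Z) (x : R) : sin (x + IZR k * (2 * PI)) = sin x.
Proof.
destruct (Z.le_gt_cases 0 k) as [K|K].
- rewrite <- (Z2Nat.id k) by lia. rewrite <- INR_IZR_INZ.
  replace (x + _) with (x + 2 * INR (Z.to_nat k) * PI) by ring. apply sin_period.
- replace k with (- Z.of_nat (Z.to_nat (- k)))%Z by lia.
  rewrite opp_IZR, <- INR_IZR_INZ.
  rewrite <- (sin_period _ (Z.to_nat (- k))). f_equal; ring.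
Qed.

Lemma cos_sin_INR_PI (n : nat) : cos (INR n * PI) = (-1) ^ n /\ sin (INR n * PI) = 0.
Proof.
induction n as [|n [IH1 IH2]].
- simpl. rewrite Rmult_0_l, cos_0, sin_0. easy.
- rewrite S_INR, Rmult_plus_distr_r, Rmult_1_l, neg_cos, neg_sin, IH1, IH2.
  split; simpl; ring.
Qed.

Lemma is_RInt_cos (k : Z) (x : R) :
  is_RInt (fun t => cos (IZR k * t + x)) 0 (2 * PI)
    (if Z.eq_dec k 0 then 2 * PI * cos x else 0).
Proof.
destruct (Z.eq_dec k 0) as [->|K].
- apply is_RInt_ext with (fun _ => cos x).
  + intros t _; f_equal; ring.
  + replace (2 * PI * cos x) with (scal (2 * PI - 0) (cos x))
      by (unfold scal; simpl; unfold mult; simpl; ring).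
    apply (@is_RInt_const R_CompleteNormedModule).
- assert (K' : IZR k <> 0) by now apply not_0_IZR.
  replace 0 with (minus (sin (IZR k * (2 * PI) + x) / IZR k)
     (sin (IZR k * 0 + x) / IZR k)) at 2.
  2: { rewrite (Rplus_comm (_ * (2 * PI))), sin_period_Z.
       replace (IZR k * 0 + x) with x by ring. apply (minus_eq_zero (G := R_AbelianGroup)). }
  apply (is_RInt_derive (fun t => sin (IZR k * t + x) / IZR k)).
  + intros t _. auto_derive; [easy|]. field; easy.
  + intros t _. apply (ex_derive_continuous (V := R_NormedModule)).
    auto_derive; easy.
Qed.

(* By the product-to-sum formulas, with the sines written as shifted cosines. *)
Lemma is_RInt_trig_mul (a b x : R) (n m : nat) :
  is_RInt (fun t => (a * cos (INR n * t) + b * sin (INR n * t)) * cos (INR m * (t - x)))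
    0 (2 * PI)
    (if Nat.eq_dec n m then
       PI * (a * cos (INR n * x) + b * sin (INR n * x) + (if Nat.eq_dec n 0 then a else 0))
     else 0).
Proof.
set (k := (Z.of_nat n + Z.of_nat m)%Z). set (l := (Z.of_nat n - Z.of_nat m)%Z).
set (y := INR m * x).
assert (Ek : IZR k = INR n + INR m) by (unfold k; now rewrite plus_IZR, !INR_IZR_INZ).
assert (El : IZR l = INR n - INR m) by (unfold l; now rewrite minus_IZR, !INR_IZR_INZ).
assert (C := fun c k x => is_RInt_scal _ _ _ c _ (is_RInt_cos k x)).
assert (H := is_RInt_plus _ _ _ _ _ _
  (is_RInt_plus _ _ _ _ _ _ (C (a / 2) k (- y)) (C (a / 2) l y))
  (is_RInt_plus _ _ _ _ _ _ (C (b / 2) k (- y - PI / 2)) (C (b / 2) l (y - PI / 2)))).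
unfold plus, scal in H; simpl in H; unfold mult in H; simpl in H.
assert (S : forall u, cos (u - PI / 2) = sin u).
{ intros u. rewrite cos_minus, cos_PI2, sin_PI2; ring. }
match type of H with is_RInt ?f _ _ ?v => replace (if Nat.eq_dec n m then _ else _) with v end.
- refine (is_RInt_ext _ _ _ _ _ _ H).
  intros t _. rewrite Ek, El.
  replace ((INR n + INR m) * t + (- y - PI / 2)) with ((INR n * t + (INR m * t - y)) - PI / 2) by ring.
  replace ((INR n - INR m) * t + (y - PI / 2)) with ((INR n * t - (INR m * t - y)) - PI / 2) by ring.
  replace ((INR n + INR m) * t + - y) with (INR n * t + (INR m * t - y)) by ring.
  replace ((INR n - INR m) * t + y) with (INR n * t - (INR m * t - y)) by ring.
  replace (INR m * (t - x)) with (INR m * t - y) by (unfold y; ring).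
  generalize (INR m * t - y); intros z.
  rewrite !S, cos_plus, cos_minus, sin_plus, sin_minus.
  real_eq. field.
- rewrite !S.
  destruct (Nat.eq_dec n m) as [<-|D].
  + destruct (Z.eq_dec l 0) as [_|E]; [|exfalso; apply E; unfold l; lia].
    destruct (Nat.eq_dec n 0) as [->|N].
    * destruct (Z.eq_dec k 0) as [_|E]; [|exfalso; apply E; unfold k; lia].
      unfold y; simpl INR. rewrite !Rmult_0_l, Ropp_0, cos_0, sin_0. field.
    * destruct (Z.eq_dec k 0) as [E|_]; [exfalso; unfold k in E; lia|].
      unfold y; field.
  + destruct (Z.eq_dec l 0) as [E|_]; [exfalso; unfold l in E; lia|].
    destruct (Z.eq_dec k 0) as [E|_]; [exfalso; unfold k in E; lia|].
    ring.
Qed.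

Lemma sum_n_Rmult_l (c : R) (u : nat -> R) (N : nat) :
  sum_n (fun n => c * u n) N = c * sum_n u N.
Proof. exact (sum_n_mult_l (K := R_Ring) c u N). Qed.

Lemma sum_n_Rplus (u v : nat -> R) (N : nat) :
  sum_n (fun n => u n + v n) N = sum_n u N + sum_n v N.
Proof. exact (sum_n_plus u v N). Qed.

Lemma sum_n_RS (u : nat -> R) (N : nat) : sum_n u (S N) = sum_n u N + u (S N).
Proof. exact (sum_Sn u N). Qed.

Lemma sum_n_nonzero_at (g : nat -> R) (m N : nat) : (m <= N)%nat ->
  sum_n (fun n => if Nat.eq_dec n m then g n else 0) N = g m.
Proof.
assert (Z : forall N, (N < m)%nat -> sum_n (fun n => if Nat.eq_dec n m then g n else 0) N = 0).
{ induction N0 as [|N0 IH]; intros L.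
  - rewrite sum_O. destruct (Nat.eq_dec 0 m); [lia|easy].
  - rewrite sum_Sn, IH by lia. destruct (Nat.eq_dec (S N0) m); [lia|]. apply (plus_zero_l (G := R_AbelianGroup)). }
induction N as [|N IH]; intros L.
- rewrite sum_O. destruct (Nat.eq_dec 0 m); [now subst|lia].
- rewrite sum_Sn. destruct (Nat.eq_dec (S N) m) as [<-|D].
  + rewrite Z by lia. apply (plus_zero_l (G := R_AbelianGroup)).
  + rewrite IH by lia. apply (plus_zero_r (G := R_AbelianGroup)).
Qed.

Lemma is_series_single (v : R) (m : nat) :
  is_series (fun n => if Nat.eq_dec n m then v else 0) v.
Proof.
apply (filterlim_ext_loc (fun _ => v)); [|apply filterlim_const].
exists m. intros N L. now rewrite (sum_n_nonzero_at (fun _ => v)).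
Qed.

Lemma is_RInt_sum_n (f : nat -> R -> R) (v : nat -> R) (a b : R) (N : nat) :
  (forall n, is_RInt (f n) a b (v n)) ->
  is_RInt (fun t => sum_n (fun n => f n t) N) a b (sum_n v N).
Proof.
intros H. induction N as [|N IH].
- rewrite sum_O. apply is_RInt_ext with (2 := H 0%nat). intros t _; now rewrite sum_O.
- rewrite sum_Sn. apply is_RInt_ext with (2 := is_RInt_plus _ _ _ _ _ _ IH (H (S N))).
  intros t _; now rewrite sum_Sn.
Qed.

Definition trig (a b : nat -> R) (t : R) (n : nat) : R :=
  a n * cos (INR n * t) + b n * sin (INR n * t).

(** Let k be the cosine polynomial with coefficients c, and integrate the nonnegative product p(t)
    k(t - x) over a period. By orthogonality each frequency contributes pi times a product, and
    frequency 0 twice as much, whence the extra term c_0 a_0. *)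
Lemma trig_poly_pairing (a b c : nat -> R) (x : R) (N : nat) :
  (forall t, 0 <= sum_n (trig a b t) N) ->
  (forall t, 0 <= sum_n (fun m => c m * cos (INR m * t)) N) ->
  0 <= c 0%nat * a 0%nat + sum_n (fun m => c m * trig a b x m) N.
Proof.
intros Ha Hc.
set (v n m := if Nat.eq_dec n m then
  PI * (trig a b x n + (if Nat.eq_dec n 0 then a n else 0)) else 0).
assert (I : is_RInt (fun t => sum_n (fun m => c m * sum_n (fun n =>
    trig a b t n * cos (INR m * (t - x))) N) N) 0 (2 * PI)
  (sum_n (fun m => c m * sum_n (fun n => v n m) N) N)).
{ apply (is_RInt_sum_n (fun m t => c m * sum_n (fun n =>
    trig a b t n * cos (INR m * (t - x))) N)).
  intros m. apply (is_RInt_scal (V := R_NormedModule)).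
  apply (is_RInt_sum_n (fun n t => trig a b t n * cos (INR m * (t - x)))).
  intros n. apply is_RInt_trig_mul. }
assert (P : 0 <= sum_n (fun m => c m * sum_n (fun n => v n m) N) N).
{ replace 0 with ((2 * PI - 0) * 0) by ring.
  apply (is_RInt_le (fun _ => 0) _ 0 (2 * PI) _ _) with (3 := I).
  - pose proof PI_RGT_0; lra.
  - apply (@is_RInt_const R_CompleteNormedModule).
  - intros t _.
    replace (sum_n _ N) with (sum_n (trig a b t) N * sum_n (fun m => c m * cos (INR m * (t - x))) N).
    + apply Rmult_le_pos; [apply Ha|apply Hc].
    + rewrite <- sum_n_Rmult_l. apply sum_n_ext; intros m.
      replace (sum_n (fun n => trig a b t n * cos (INR m * (t - x))) N)
        with (cos (INR m * (t - x)) * sum_n (trig a b t) N)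
        by (rewrite <- sum_n_Rmult_l; apply sum_n_ext; intros n; apply Rmult_comm).
      real_eq. ring. }
replace (sum_n _ N) with (PI * (c 0%nat * a 0%nat + sum_n (fun m => c m * trig a b x m) N)) in P.
{ pose proof PI_RGT_0. nra. }
rewrite (sum_n_ext_loc (fun m => c m * sum_n (fun n => v n m) N)
  (fun m => (if Nat.eq_dec m 0 then PI * (c m * a m) else 0) + (PI * (c m * trig a b x m)))).
- rewrite sum_n_Rplus, (sum_n_nonzero_at (fun m => PI * (c m * a m))) by lia.
  rewrite sum_n_Rmult_l. ring.
- intros m L. unfold v.
  rewrite (sum_n_nonzero_at (fun n => PI * (trig a b x n + (if Nat.eq_dec n 0 then a n else 0)))) by easy.
  real_eq. destruct (Nat.eq_dec m 0); ring.
Qed.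

(** The second factor is the truncated Poisson kernel 1 + 2 s cos t + 2 s^2 cos 2t + ...; the last
    term on the right is its exact truncation error, with the denominator cleared. *)
Lemma poisson_kernel_sum (s t : R) (N : nat) :
  (1 - 2 * s * cos t + s ^ 2) * (2 * sum_n (fun m => s ^ m * cos (INR m * t)) N - 1) =
  1 - s ^ 2 - 2 * s ^ S N * (cos (INR (S N) * t) - s * cos (INR N * t)).
Proof.
induction N as [|N IH].
- rewrite sum_O. change (INR 1) with 1. change (INR 0) with 0.
  replace (0 * t) with 0 by ring. replace (1 * t) with t by ring. rewrite cos_0. simpl. ring.
- rewrite sum_n_RS.
  transitivity ((1 - 2 * s * cos t + s ^ 2) * (2 * sum_n (fun m => s ^ m * cos (INR m * t)) N - 1)
    + 2 * (1 - 2 * s * cos t + s ^ 2) * s ^ S N * cos (INR (S N) * t)); [ring|].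
  rewrite IH.
  (* The three-term recurrence of the cosines. *)
  assert (E : cos (INR (S (S N)) * t) = 2 * cos t * cos (INR (S N) * t) - cos (INR N * t)).
  { rewrite !S_INR.
    replace ((INR N + 1 + 1) * t) with ((INR N + 1) * t + t) by ring.
    replace (INR N * t) with ((INR N + 1) * t - t) by ring.
    rewrite cos_plus, cos_minus; ring. }
  rewrite E. simpl pow. ring.
Qed.

(** The full kernel (1 - s^2) / D is least where cos t = -1, with value (1 - s) / (1 + s). The
    truncation error is at most 4 s^(N+1) / D, and D >= (1 - s)^2. *)
Lemma poisson_kernel_lower (s t : R) (N : nat) : 0 <= s < 1 ->
  (1 - s) / (1 + s) - 4 * s ^ S N / (1 - s) ^ 2 <=
  2 * sum_n (fun m => s ^ m * cos (INR m * t)) N - 1.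
Proof.
intros Hs.
set (D := 1 - 2 * s * cos t + s ^ 2).
pose proof (COS_bound t) as C.
assert (D1 : (1 - s) ^ 2 <= D) by (unfold D; nra).
assert (D2 : D <= (1 + s) ^ 2) by (unfold D; nra).
assert (P1 : 0 < (1 - s) ^ 2) by (apply pow_lt; lra).
apply Rmult_le_reg_l with D; [lra|].
unfold D at 2; rewrite poisson_kernel_sum.
assert (P2 := pow_le s (S N) (proj1 Hs)).
pose proof (COS_bound (INR (S N) * t)) as C1. pose proof (COS_bound (INR N * t)) as C2.
assert (K1 : D * ((1 - s) / (1 + s)) <= 1 - s ^ 2).
{ apply Rle_trans with ((1 + s) ^ 2 * ((1 - s) / (1 + s))).
  - apply Rmult_le_compat_r; [apply Rdiv_le_0_compat; lra|easy].
  - right; field; lra. }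
assert (K2 : 4 * s ^ S N <= D * (4 * s ^ S N / (1 - s) ^ 2)).
{ apply Rle_trans with ((1 - s) ^ 2 * (4 * s ^ S N / (1 - s) ^ 2)).
  - right; field; lra.
  - apply Rmult_le_compat_r; [apply Rdiv_le_0_compat; lra|easy]. }
assert (K3 : s ^ S N * (cos (INR (S N) * t) - s * cos (INR N * t)) <= s ^ S N * 2).
{ apply Rmult_le_compat_l; [easy|]. nra. }
lra.
Qed.

Lemma series_tail_geom (u : nat -> R) (l c q : R) (N : nat) :
  0 <= c -> 0 <= q < 1 -> (forall n, Rabs (u n) <= c * q ^ n) -> is_series u l ->
  Rabs (l - sum_n u N) <= c * q ^ S N / (1 - q).
Proof.
intros Hc Hq Hu H.
(* The finite geometric sum is kept exact so that the induction closes. *)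
assert (K : forall k, Rabs (sum_n u (k + N) - sum_n u N) <=
    c * (q ^ S N - q ^ S (k + N)) / (1 - q)).
{ induction k as [|k IH].
  - replace (_ - _) with 0 by (simpl; ring). rewrite Rabs_R0. right; simpl; field; lra.
  - change (S k + N)%nat with (S (k + N)). rewrite sum_n_RS.
    replace (_ - _) with ((sum_n u (k + N) - sum_n u N) + u (S (k + N))) by ring.
    eapply Rle_trans; [apply Rabs_triang|].
    eapply Rle_trans; [apply Rplus_le_compat; [apply IH|apply Hu]|].
    right. simpl pow. field; lra. }
assert (B : forall k, Rabs (sum_n u (k + N) - sum_n u N) <= c * q ^ S N / (1 - q)).
{ intros k. eapply Rle_trans; [apply K|].
  apply Rmult_le_compat_r; [left; apply Rinv_0_lt_compat; lra|].
  apply Rmult_le_compat_l; [easy|]. pose proof (pow_le q (S (k + N)) (proj1 Hq)); lra. }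
assert (L : is_lim_seq (fun k => Rabs (sum_n u (k + N) - sum_n u N)) (Rabs (l - sum_n u N))).
{ apply (is_lim_seq_abs _ (l - sum_n u N)).
  apply is_lim_seq_minus'; [|apply is_lim_seq_const].
  apply (is_lim_seq_incr_n (sum_n u) N), H. }
exact (is_lim_seq_le _ _ _ _ B L (is_lim_seq_const _)).
Qed.

Lemma is_lim_seq_geom_scal (c q : R) : 0 <= q < 1 -> is_lim_seq (fun n => c * q ^ S n) 0.
Proof.
intros Hq. replace 0 with (c * 0) by ring.
apply is_lim_seq_mult'; [apply is_lim_seq_const|].
apply (is_lim_seq_incr_1 (fun n => q ^ n)), is_lim_seq_geom.
rewrite Rabs_pos_eq; lra.
Qed.

(** * Nonnegative trigonometric series: coefficient bound and Harnack's inequality *)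

Section NonnegativeTrigSeries.

Variables (a b : nat -> R) (p : R -> R) (c q : R).
Hypothesis Hc : 0 <= c.
Hypothesis Hq : 0 <= q < 1.
Hypothesis Ha : forall n, Rabs (a n) <= c * q ^ n.
Hypothesis Hb : forall n, Rabs (b n) <= c * q ^ n.
Hypothesis Hp : forall t, is_series (trig a b t) (p t).
Hypothesis p_ge_0 : forall t, 0 <= p t.

Lemma trig_bound (t : R) (n : nat) : Rabs (trig a b t n) <= 2 * c * q ^ n.
Proof.
unfold trig. eapply Rle_trans; [apply Rabs_triang|]. rewrite !Rabs_mult.
pose proof (Ha n). pose proof (Hb n).
pose proof (COS_bound (INR n * t)). pose proof (SIN_bound (INR n * t)).
assert (Rabs (cos (INR n * t)) <= 1) by (apply Rabs_le; lra).
assert (Rabs (sin (INR n * t)) <= 1) by (apply Rabs_le; lra).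
pose proof (Rabs_pos (a n)). pose proof (Rabs_pos (b n)). nra.
Qed.

(** A truncation of p need not be nonnegative, but it becomes so once its constant term is raised by
    the tail bound e. Then [trig_poly_pairing] applies, and e enters twice because the constant term
    does. *)
Lemma trig_series_pairing (d : nat -> R) (x : R) (N : nat) :
  (forall t, 0 <= sum_n (fun m => d m * cos (INR m * t)) N) ->
  0 <= d 0%nat * a 0%nat + sum_n (fun m => d m * trig a b x m) N
     + 4 * c / (1 - q) * q ^ S N * d 0%nat.
Proof.
intros Hd.
set (e := 2 * c * q ^ S N / (1 - q)).
set (a' n := a n + (if Nat.eq_dec n 0 then e else 0)).
assert (T : forall g t, sum_n (fun m => g m * trig a' b t m) N
  = sum_n (fun m => g m * trig a b t m) N + g 0%nat * e).
{ intros g t.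
  rewrite (sum_n_ext _ (fun m => g m * trig a b t m
    + (if Nat.eq_dec m 0 then (fun m => g m * e) m else 0))).
  - rewrite sum_n_Rplus, (sum_n_nonzero_at (fun m => g m * e)) by lia. easy.
  - intros m. unfold trig, a'.
    real_eq.
    destruct (Nat.eq_dec m 0) as [->|_]; [|ring].
    change (INR 0) with 0. rewrite Rmult_0_l, cos_0. ring. }
assert (P := trig_poly_pairing a' b d x N).
rewrite T in P.
assert (E : a' 0%nat = a 0%nat + e) by (unfold a'; destruct (Nat.eq_dec 0 0); [easy|lia]).
rewrite E in P.
replace (_ + _) with (d 0%nat * (a 0%nat + e) + (sum_n (fun m => d m * trig a b x m) N + d 0%nat * e)).
2: { unfold e; field; lra. }
apply P; [|exact Hd].
intros t.
replace (sum_n (trig a' b t) N) with (sum_n (fun m => 1 * trig a' b t m) N)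
  by (rewrite sum_n_Rmult_l; apply Rmult_1_l).
rewrite T, sum_n_Rmult_l.
assert (S := series_tail_geom _ _ (2 * c) q N ltac:(lra) Hq (trig_bound t) (Hp t)).
fold e in S. apply Rabs_le_between in S. pose proof (p_ge_0 t).
lra.
Qed.

(** The pairing is with the nonnegative kernel 1 + cos(n t); the truncation error tends to 0. *)
Lemma trig_series_coeff_le (n : nat) (x : R) : (1 <= n)%nat ->
  - trig a b x n <= 2 * a 0%nat.
Proof.
intros Hn.
set (d m := if Nat.eq_dec m n then 1 else if Nat.eq_dec m 0 then 1 else 0).
assert (D : forall g N, (n <= N)%nat -> sum_n (fun m => d m * g m) N = g n + g 0%nat).
{ intros g N L.
  rewrite (sum_n_ext _ (fun m => (if Nat.eq_dec m n then g m else 0)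
    + (if Nat.eq_dec m 0 then g m else 0))).
  - rewrite sum_n_Rplus, !sum_n_nonzero_at by lia; easy.
  - intros m; unfold d. real_eq.
    destruct (Nat.eq_dec m n), (Nat.eq_dec m 0); try lia; real_eq; ring. }
assert (T0 : trig a b x 0 = a 0%nat).
{ unfold trig. change (INR 0) with 0. rewrite Rmult_0_l, cos_0, sin_0. ring. }
assert (D0 : d 0%nat = 1) by (unfold d; destruct (Nat.eq_dec 0 n); [easy|now destruct (Nat.eq_dec 0 0)]).
assert (B : forall N, (n <= N)%nat ->
  - trig a b x n <= 2 * a 0%nat + 4 * c / (1 - q) * q ^ S N).
{ intros N L.
  assert (P := trig_series_pairing d x N).
  rewrite D, T0, D0 in P by easy.
  enough (forall t, 0 <= sum_n (fun m => d m * cos (INR m * t)) N) by (specialize (P H); lra).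
  intros t. rewrite (D (fun m => cos (INR m * t))) by easy.
  change (INR 0) with 0. rewrite Rmult_0_l, cos_0. pose proof (COS_bound (INR n * t)); lra. }
assert (L := is_lim_seq_plus' _ _ _ _ (is_lim_seq_const (2 * a 0%nat))
  (is_lim_seq_geom_scal (4 * c / (1 - q)) q Hq)).
rewrite Rplus_0_r in L.
refine (is_lim_seq_le_loc _ _ _ _ _ (is_lim_seq_const _) L).
exists n; exact B.
Qed.

(** The pairing is with the Poisson kernel minus its minimum k. The truncated kernel stays
    nonnegative after e N, a bound of its truncation error, is added. *)
Lemma trig_series_harnack (s x l : R) : 0 <= s < 1 ->
  is_series (fun n => s ^ n * trig a b x n) l ->
  a 0%nat * ((1 - s) / (1 + s)) <= l.
Proof.
intros Hs Hl.
set (k := (1 - s) / (1 + s)).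
set (e N := 4 / (1 - s) ^ 2 * s ^ S N).
assert (B : forall N, 0 <= 2 * sum_n (fun n => s ^ n * trig a b x n) N - 2 * k * a 0%nat
  + 2 * a 0%nat * e N + 4 * c / (1 - q) * q ^ S N * (1 - k + e N)).
{ intros N.
  (* Coefficients of the kernel 2 sum s^m cos(m t) - 1 - k + e N, whose constants are gathered at m
     = 0. *)
  set (d m := 2 * s ^ m - (if Nat.eq_dec m 0 then 1 + k - e N else 0)).
  assert (D : forall g, sum_n (fun m => d m * g m) N =
    2 * sum_n (fun m => s ^ m * g m) N - (1 + k - e N) * g 0%nat).
  { intros g. rewrite (sum_n_ext _ (fun m => 2 * (s ^ m * g m)
      + (if Nat.eq_dec m 0 then - (1 + k - e N) * g m else 0))).
    - rewrite sum_n_Rplus, sum_n_Rmult_l, (sum_n_nonzero_at (fun m => - (1 + k - e N) * g m)) by lia.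
      real_eq; ring.
    - intros m; unfold d. real_eq.
      destruct (Nat.eq_dec m 0); ring. }
  assert (P := trig_series_pairing d x N).
  rewrite D in P.
  assert (D0 : d 0%nat = 1 - k + e N).
  { unfold d; destruct (Nat.eq_dec 0 0); [simpl; ring|easy]. }
  assert (T0 : trig a b x 0 = a 0%nat).
  { unfold trig. change (INR 0) with 0. rewrite Rmult_0_l, cos_0, sin_0. ring. }
  rewrite D0, T0 in P.
  enough (forall t, 0 <= sum_n (fun m => d m * cos (INR m * t)) N) by (specialize (P H); lra).
  intros t. rewrite (D (fun m => cos (INR m * t))).
  change (INR 0) with 0. rewrite Rmult_0_l, cos_0.
  pose proof (poisson_kernel_lower s t N Hs) as K. fold k in K.
  replace (e N) with (4 * s ^ S N / (1 - s) ^ 2) by (unfold e; field; lra). lra. }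
assert (Le : is_lim_seq e 0) by apply (is_lim_seq_geom_scal _ s Hs).
assert (Lq := is_lim_seq_geom_scal (4 * c / (1 - q)) q Hq).
assert (LS : is_lim_seq (sum_n (fun n => s ^ n * trig a b x n)) l) by exact Hl.
assert (C := is_lim_seq_const).
assert (L := is_lim_seq_plus' _ _ _ _ (is_lim_seq_plus' _ _ _ _
  (is_lim_seq_minus' _ _ _ _ (is_lim_seq_mult' _ _ _ _ (C 2) LS) (C (2 * k * a 0%nat)))
  (is_lim_seq_mult' _ _ _ _ (C (2 * a 0%nat)) Le))
  (is_lim_seq_mult' _ _ _ _ Lq (is_lim_seq_plus' _ _ _ _ (C (1 - k)) Le))).
assert (F := is_lim_seq_le _ _ _ _ B (C 0) L). simpl in F. lra.
Qed.

End NonnegativeTrigSeries.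

(** * Taylor expansion of holomorphic functions *)

Lemma is_series_of_geom_bound (u : nat -> R) (l c q : R) : 0 <= q < 1 ->
  (forall N, Rabs (sum_n u N - l) <= c * q ^ S N) -> is_series u l.
Proof.
intros Hq H.
assert (C := is_lim_seq_geom_scal c q Hq).
assert (L : is_lim_seq (sum_n u) l).
{ apply (is_lim_seq_le_le (fun N => l - c * q ^ S N) _ (fun N => l + c * q ^ S N)).
  - intros N. specialize (H N). apply Rabs_le_between in H. lra.
  - replace (Finite l) with (Finite (l - 0)) by (f_equal; ring).
    apply is_lim_seq_minus'; [apply is_lim_seq_const|exact C].
  - replace (Finite l) with (Finite (l + 0)) by (f_equal; ring).
    apply is_lim_seq_plus'; [apply is_lim_seq_const|exact C]. }
exact L.
Qed.

(** This and [poisson_kernel_sum] are the imaginary and real parts of the partial sums of the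
    geometric series in s exp(i t). *)
Lemma geom_sin_sum (s t : R) (N : nat) :
  (1 - 2 * s * cos t + s ^ 2) * sum_n (fun m => s ^ m * sin (INR m * t)) N =
  s * sin t - s ^ S N * (sin (INR (S N) * t) - s * sin (INR N * t)).
Proof.
induction N as [|N IH].
- rewrite sum_O. change (INR 1) with 1. change (INR 0) with 0.
  replace (0 * t) with 0 by ring. replace (1 * t) with t by ring. rewrite sin_0. simpl. ring.
- rewrite sum_n_RS, Rmult_plus_distr_l, IH.
  assert (E : sin (INR (S (S N)) * t) = 2 * cos t * sin (INR (S N) * t) - sin (INR N * t)).
  { rewrite !S_INR.
    replace ((INR N + 1 + 1) * t) with ((INR N + 1) * t + t) by ring.
    replace (INR N * t) with ((INR N + 1) * t - t) by ring.
    rewrite sin_plus, sin_minus; ring. }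
  rewrite E. simpl pow. ring.
Qed.

Lemma poisson_denom_ge (q t : R) : 0 <= q < 1 -> (1 - q) ^ 2 <= 1 - 2 * q * cos t + q ^ 2.
Proof. intros Hq. pose proof (COS_bound t). nra. Qed.

Lemma is_series_geom_cos (q t : R) : 0 <= q < 1 ->
  is_series (fun n => q ^ n * cos (INR n * t)) ((1 - q * cos t) / (1 - 2 * q * cos t + q ^ 2)).
Proof.
intros Hq.
apply (is_series_of_geom_bound _ _ (2 / (1 - q) ^ 2) q Hq). intros N.
pose proof (poisson_denom_ge q t Hq) as D. pose proof (poisson_kernel_sum q t N) as E.
assert (P : 0 < (1 - q) ^ 2) by (apply pow_lt; lra).
set (d := 1 - 2 * q * cos t + q ^ 2) in *.
replace (_ - _) with (/ d * (- q ^ S N * (cos (INR (S N) * t) - q * cos (INR N * t)))).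
2: { apply Rmult_eq_reg_l with (2 * d); [|lra].
     transitivity (2 * (- q ^ S N * (cos (INR (S N) * t) - q * cos (INR N * t)))); [field; lra|].
     transitivity (d * (2 * sum_n (fun m => q ^ m * cos (INR m * t)) N - 1) + d - 2 * (1 - q * cos t)); [|field; lra].
     rewrite E. unfold d. ring. }
rewrite !Rabs_mult, Rabs_Ropp, (Rabs_pos_eq (q ^ _)) by (apply pow_le; lra).
rewrite (Rabs_pos_eq (/ d)) by (left; apply Rinv_0_lt_compat; lra).
assert (I : / d <= / (1 - q) ^ 2) by (apply Rinv_le_contravar; lra).
assert (I' : 0 < / d) by (apply Rinv_0_lt_compat; lra).
pose proof (COS_bound (INR (S N) * t)) as C1. pose proof (COS_bound (INR N * t)) as C2.
assert (B : Rabs (cos (INR (S N) * t) - q * cos (INR N * t)) <= 2) by (apply Rabs_le; nra).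
pose proof (pow_le q (S N) (proj1 Hq)).
replace (2 / _ * _) with (/ (1 - q) ^ 2 * (q ^ S N * 2)) by (field; lra).
apply Rmult_le_compat; [lra| |easy|].
- apply Rmult_le_pos; [easy|apply Rabs_pos].
- apply Rmult_le_compat_l; easy.
Qed.

Lemma is_series_geom_sin (q t : R) : 0 <= q < 1 ->
  is_series (fun n => q ^ n * sin (INR n * t)) (q * sin t / (1 - 2 * q * cos t + q ^ 2)).
Proof.
intros Hq.
apply (is_series_of_geom_bound _ _ (2 / (1 - q) ^ 2) q Hq). intros N.
pose proof (poisson_denom_ge q t Hq) as D. pose proof (geom_sin_sum q t N) as E.
assert (P : 0 < (1 - q) ^ 2) by (apply pow_lt; lra).
set (d := 1 - 2 * q * cos t + q ^ 2) in *.
replace (_ - _) with (/ d * (- q ^ S N * (sin (INR (S N) * t) - q * sin (INR N * t)))).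
2: { apply Rmult_eq_reg_l with d; [|lra].
     transitivity (- q ^ S N * (sin (INR (S N) * t) - q * sin (INR N * t))); [field; lra|].
     transitivity (d * sum_n (fun m => q ^ m * sin (INR m * t)) N - q * sin t); [|field; lra].
     rewrite E. ring. }
rewrite !Rabs_mult, Rabs_Ropp, (Rabs_pos_eq (q ^ _)) by (apply pow_le; lra).
rewrite (Rabs_pos_eq (/ d)) by (left; apply Rinv_0_lt_compat; lra).
assert (I : / d <= / (1 - q) ^ 2) by (apply Rinv_le_contravar; lra).
assert (I' : 0 < / d) by (apply Rinv_0_lt_compat; lra).
pose proof (SIN_bound (INR (S N) * t)) as C1. pose proof (SIN_bound (INR N * t)) as C2.
assert (B : Rabs (sin (INR (S N) * t) - q * sin (INR N * t)) <= 2) by (apply Rabs_le; nra).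
pose proof (pow_le q (S N) (proj1 Hq)).
replace (2 / _ * _) with (/ (1 - q) ^ 2 * (q ^ S N * 2)) by (field; lra).
apply Rmult_le_compat; [lra| |easy|].
- apply Rmult_le_pos; [easy|apply Rabs_pos].
- apply Rmult_le_compat_l; easy.
Qed.

Lemma continuous_Rmult (f g : R -> R) (t : R) :
  continuous f t -> continuous g t -> continuous (fun x => f x * g x) t.
Proof. exact (continuous_mult (K := R_AbsRing) f g t). Qed.

Lemma continuous_Rplus (f g : R -> R) (t : R) :
  continuous f t -> continuous g t -> continuous (fun x => f x + g x) t.
Proof. exact (continuous_plus (K := R_AbsRing) (V := R_NormedModule) f g t). Qed.

(* The integrand is the real part of [(g + i h) / (1 - q exp (i (x - t)))], expanded
   as a geometric series. *)
Lemma is_series_cauchy_kernel (g h : R -> R) (q x : R) : 0 <= q < 1 ->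
  (forall t, continuous g t) -> (forall t, continuous h t) ->
  is_series
    (fun n => q ^ n * RInt (fun t => g t * cos (INR n * (t - x)) + h t * sin (INR n * (t - x)))
       0 (2 * PI))
    (RInt (fun t => (g t * (1 - q * cos (t - x)) + h t * (q * sin (t - x)))
       / (1 - 2 * q * cos (t - x) + q ^ 2)) 0 (2 * PI)).
Proof.
intros Hq Hg Hh.
pose proof PI_RGT_0 as PI0.
set (kc t := (1 - q * cos (t - x)) / (1 - 2 * q * cos (t - x) + q ^ 2)).
set (ks t := q * sin (t - x) / (1 - 2 * q * cos (t - x) + q ^ 2)).
set (sc N t := sum_n (fun n => q ^ n * cos (INR n * (t - x))) N).
set (ss N t := sum_n (fun n => q ^ n * sin (INR n * (t - x))) N).
assert (Dpos : forall t, 0 < 1 - 2 * q * cos (t - x) + q ^ 2).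
{ intros t. apply Rlt_le_trans with ((1 - q) ^ 2); [apply pow_lt; lra|now apply poisson_denom_ge]. }
assert (cv_ex : forall f : R -> R, (forall t, continuous f t) -> ex_RInt f 0 (2 * PI)).
{ intros f Hf. apply (ex_RInt_continuous (V := R_CompleteNormedModule)). intros; apply Hf. }
assert (Ckc : forall t, continuous kc t).
{ intros t. apply (ex_derive_continuous (V := R_NormedModule)). unfold kc. auto_derive.
  generalize (Dpos t). unfold Rminus. simpl. lra. }
assert (Cks : forall t, continuous ks t).
{ intros t. apply (ex_derive_continuous (V := R_NormedModule)). unfold ks. auto_derive.
  generalize (Dpos t). unfold Rminus. simpl. lra. }
set (G n t := q ^ n * (g t * cos (INR n * (t - x)) + h t * sin (INR n * (t - x)))).
assert (RG : forall N, is_RInt (fun t => sum_n (fun n => G n t) N) 0 (2 * PI)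
   (sum_n (fun n => q ^ n * RInt (fun t => g t * cos (INR n * (t - x)) + h t * sin (INR n * (t - x)))
       0 (2 * PI)) N)).
{ intros N. apply is_RInt_sum_n. intros n.
  apply (is_RInt_scal (V := R_NormedModule)). apply (RInt_correct (V := R_CompleteNormedModule)), cv_ex.
  intros t. apply continuous_Rplus; apply continuous_Rmult; try easy;
    apply (ex_derive_continuous (V := R_NormedModule)); auto_derive; easy. }
assert (SG : forall N t, sum_n (fun n => G n t) N = g t * sc N t + h t * ss N t).
{ intros N t. unfold sc, ss. rewrite <- !sum_n_Rmult_l, <- sum_n_Rplus.
  apply sum_n_ext. intros n. unfold G.
  real_eq. ring. }
assert (CL : forall t, continuous (fun t => g t * kc t + h t * ks t) t).
{ intros t. apply continuous_Rplus; apply continuous_Rmult; easy. }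
replace (RInt _ 0 (2 * PI)) with (RInt (fun t => g t * kc t + h t * ks t) 0 (2 * PI)).
2: { apply RInt_ext. intros t _. unfold kc, ks.
     real_eq. field. apply Rgt_not_eq, Dpos. }
(* The tails of both geometric series are at most q^(N+1) / (1 - q) uniformly in t, which justifies
   exchanging sum and integral with an error governed by M. *)
set (M := RInt (fun t => Rabs (g t) + Rabs (h t)) 0 (2 * PI)).
apply (is_series_of_geom_bound _ _ (M / (1 - q)) q Hq). intros N.
rewrite <- (is_RInt_unique _ _ _ _ (RG N)).
assert (E1 : ex_RInt (fun t => sum_n (fun n => G n t) N) 0 (2 * PI)) by (eexists; apply RG).
assert (EM := RInt_minus (V := R_CompleteNormedModule) _ _ _ _ E1 (cv_ex _ CL)).
match type of EM with ?l = _ => replace (_ - _) with l by exact EM end. clear EM.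
eapply Rle_trans; [apply abs_RInt_le; [lra|]|].
{ apply (ex_RInt_minus (V := R_NormedModule)); [exact E1|apply cv_ex, CL]. }
replace (M / (1 - q) * q ^ S N) with (scal (q ^ S N / (1 - q)) M)
  by (unfold scal; simpl; unfold mult; simpl; field; lra).
assert (CM : forall t, continuous (fun t => Rabs (g t) + Rabs (h t)) t).
{ intros t. apply continuous_Rplus; apply (continuous_comp _ Rabs); try easy; apply continuous_Rabs. }
assert (EM := RInt_scal (V := R_CompleteNormedModule) _ _ _ (q ^ S N / (1 - q)) (cv_ex _ CM)).
match type of EM with ?l = _ => replace (scal _ M) with l by exact EM end. clear EM.
apply RInt_le; [lra| | |].
- apply (ex_RInt_norm (fun t => minus (sum_n (fun n => G n t) N) (g t * kc t + h t * ks t))).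
  apply (ex_RInt_minus (V := R_NormedModule)); [exact E1|apply cv_ex, CL].
- apply (ex_RInt_scal (V := R_NormedModule)), cv_ex, CM.
- intros t _. rewrite SG.
  change (minus ?u ?v) with (u - v). change (scal ?u ?v) with (u * v).
  assert (U : forall v n, Rabs v <= 1 -> Rabs (q ^ n * v) <= 1 * q ^ n).
  { intros v n Hv. rewrite Rabs_mult, (Rabs_pos_eq (q ^ n)) by (apply pow_le; lra).
    pose proof (pow_le q n (proj1 Hq)). nra. }
  assert (A1 := series_tail_geom _ _ 1 q N ltac:(lra) Hq
    (fun n => U _ n (Rabs_le _ _ (COS_bound _))) (is_series_geom_cos q (t - x) Hq)).
  assert (A2 := series_tail_geom _ _ 1 q N ltac:(lra) Hq
    (fun n => U _ n (Rabs_le _ _ (SIN_bound _))) (is_series_geom_sin q (t - x) Hq)).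
  fold (kc t) in A1. fold (ks t) in A2. fold (sc N t) in A1. fold (ss N t) in A2.
  rewrite Rmult_1_l in A1, A2.
  replace (_ - _) with (- (g t * (kc t - sc N t) + h t * (ks t - ss N t))) by ring.
  rewrite Rabs_Ropp. eapply Rle_trans; [apply Rabs_triang|]. rewrite !Rabs_mult.
  pose proof (Rabs_pos (g t)). pose proof (Rabs_pos (h t)).
  rewrite Rmult_plus_distr_l, !(Rmult_comm (_ / _)).
  apply Rplus_le_compat; apply Rmult_le_compat_l; easy.
Qed.

Lemma differentiable_of_partials (f fx fy : R -> R -> R) (x y : R) :
  locally_2d (fun u v => is_derive (fun z => f z v) u (fx u v)) x y ->
  is_derive (fun z => f x z) y (fy x y) -> continuity_2d_pt fx x y ->
  differentiable_pt_lim f x y (fx x y) (fy x y).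
Proof.
intros H1 H2 H3.
apply filterdiff_differentiable_pt_lim.
apply (is_derive_filterdiff f x y fx (fy x y)).
- apply locally_2d_locally in H1. exact H1.
- exact H2.
- apply continuity_2d_pt_filterlim in H3. exact H3.
Qed.

Lemma disk_open (x y : R) : x ^ 2 + y ^ 2 < 1 -> locally_2d (fun u v => u ^ 2 + v ^ 2 < 1) x y.
Proof.
intros H.
assert (C : continuity_2d_pt (fun u v => u ^ 2 + v ^ 2) x y).
{ apply (continuity_2d_pt_plus (fun u v => u ^ 2) (fun u v => v ^ 2));
    apply (continuity_1d_2d_pt_comp (fun z => z ^ 2)).
  - apply derivable_continuous_pt, derivable_pt_pow.
  - apply continuity_2d_pt_id1.
  - apply derivable_continuous_pt, derivable_pt_pow.
  - apply continuity_2d_pt_id2. }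
destruct (C (mkposreal _ (proj2 (Rlt_0_minus _ _) H))) as [d Hd].
exists d. intros u v Hu Hv. specialize (Hd u v Hu Hv). simpl pos in Hd.
apply Rabs_lt_between in Hd. lra.
Qed.

Lemma continuity_2d_pt_comp2 (f g h : R -> R -> R) (x y : R) :
  continuity_2d_pt f (g x y) (h x y) -> continuity_2d_pt g x y -> continuity_2d_pt h x y ->
  continuity_2d_pt (fun u v => f (g u v) (h u v)) x y.
Proof.
intros Hf Hg Hh eps. destruct (Hf eps) as [d Hd].
generalize (locally_2d_and _ _ _ _ (Hg d) (Hh d)).
apply locally_2d_impl, locally_2d_forall. intros u v [A B]. now apply Hd.
Qed.

Lemma continuity_2d_pt_snd (f : R -> R) (x y : R) :
  continuous f y -> continuity_2d_pt (fun _ v => f v) x y.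
Proof.
intros H. apply (continuity_1d_2d_pt_comp f (fun _ v => v)).
- apply continuity_pt_filterlim, H.
- apply continuity_2d_pt_id2.
Qed.

Lemma continuous_of_2d (f : R -> R -> R) (x y : R) :
  continuity_2d_pt f x y -> continuous (f x) y.
Proof.
intros H. apply filterlim_locally; intros eps.
exact (locally_2d_1d_const_x _ _ _ (H eps)).
Qed.

(** * Cauchy's formula and Taylor series on the unit disk *)

Section CauchyRiemann.

Variables (U V Ux Vx : R -> R -> R).
Hypothesis HUx : forall x y, x ^ 2 + y ^ 2 < 1 -> is_derive (fun z => U z y) x (Ux x y).
Hypothesis HUy : forall x y, x ^ 2 + y ^ 2 < 1 -> is_derive (fun z => U x z) y (- Vx x y).
Hypothesis HVx : forall x y, x ^ 2 + y ^ 2 < 1 -> is_derive (fun z => V z y) x (Vx x y).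
Hypothesis HVy : forall x y, x ^ 2 + y ^ 2 < 1 -> is_derive (fun z => V x z) y (Ux x y).
Hypothesis CUx : forall x y, x ^ 2 + y ^ 2 < 1 -> continuity_2d_pt Ux x y.
Hypothesis CVx : forall x y, x ^ 2 + y ^ 2 < 1 -> continuity_2d_pt Vx x y.

(** The hypotheses contain the Cauchy-Riemann equations, so F = U + i V has complex derivative Ux +
    i Vx; this is the real part of the chain rule along a curve. *)
Lemma is_derive_along_U (X Y : R -> R) (t dx dy : R) : X t ^ 2 + Y t ^ 2 < 1 ->
  is_derive X t dx -> is_derive Y t dy ->
  is_derive (fun s => U (X s) (Y s)) t (Ux (X t) (Y t) * dx + - Vx (X t) (Y t) * dy).
Proof.
intros H HX HY. apply is_derive_Reals in HX. apply is_derive_Reals in HY.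
apply is_derive_Reals.
apply (derivable_pt_lim_comp_2d U X Y); try easy.
apply (differentiable_of_partials U Ux (fun x y => - Vx x y)); auto.
generalize (disk_open _ _ H). intros [d Hd]; exists d. intros; apply HUx; auto.
Qed.

Lemma is_derive_along_V (X Y : R -> R) (t dx dy : R) : X t ^ 2 + Y t ^ 2 < 1 ->
  is_derive X t dx -> is_derive Y t dy ->
  is_derive (fun s => V (X s) (Y s)) t (Vx (X t) (Y t) * dx + Ux (X t) (Y t) * dy).
Proof.
intros H HX HY. apply is_derive_Reals in HX. apply is_derive_Reals in HY.
apply is_derive_Reals.
apply (derivable_pt_lim_comp_2d V X Y); try easy.
apply (differentiable_of_partials V Vx Ux); auto.
generalize (disk_open _ _ H). intros [d Hd]; exists d. intros; apply HVx; auto.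
Qed.

Section Homotopy.

Variables (r a b : R).
Hypothesis Hr : 0 < r < 1.
Hypothesis Hab : a ^ 2 + b ^ 2 < r ^ 2.

(** For fixed s, z_t = X + i Y moves from c = a + i b at t = 0 to z = r exp(i s) at t = 1. *)
Let X t s := a + t * (r * cos s - a).
Let Y t s := b + t * (r * sin s - b).
Let den s := r ^ 2 - 2 * r * (a * cos s + b * sin s) + (a ^ 2 + b ^ 2).
(* [k1 + i k2 = z / (z - (a + i b))] for [z = r exp (i s)]. *)
Let k1 s := (r ^ 2 - r * (a * cos s + b * sin s)) / den s.
Let k2 s := r * (b * cos s - a * sin s) / den s.
(** With F = U + i V, [G] is the real part of F(z_t) z / (z - c), and [dG] that of F'(z_t) z. *)
Let G t s := U (X t s) (Y t s) * k1 s - V (X t s) (Y t s) * k2 s.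
Let dG t s := Ux (X t s) (Y t s) * (r * cos s) - Vx (X t s) (Y t s) * (r * sin s).

Lemma inner_bound (s : R) : (a * cos s + b * sin s) ^ 2 <= a ^ 2 + b ^ 2.
Proof.
pose proof (sin2_cos2 s) as E. unfold Rsqr in E.
replace (a ^ 2 + b ^ 2) with ((a ^ 2 + b ^ 2) * (sin s * sin s + cos s * cos s)) by (rewrite E; ring).
pose proof (pow2_ge_0 (a * sin s - b * cos s)). nra.
Qed.

Lemma inner_abs (s : R) : Rabs (a * cos s + b * sin s) < r.
Proof.
pose proof (inner_bound s).
rewrite <- (Rabs_pos_eq r) by lra. apply Rsqr_lt_abs_0. rewrite !Rsqr_pow2. lra.
Qed.

Lemma den_pos (s : R) : 0 < den s.
Proof.
unfold den. pose proof (inner_bound s) as B. pose proof (inner_abs s) as C.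
apply Rabs_lt_between in C. nra.
Qed.

(** The point has modulus at most (|1 - t| + |t|) r. The condition holds on a neighbourhood of
    [0, 1], so differentiation under the integral also covers the endpoints. *)
Lemma in_disk (t s : R) : (Rabs (1 - t) + Rabs t) * r < 1 -> X t s ^ 2 + Y t s ^ 2 < 1.
Proof.
intros H.
pose proof (sin2_cos2 s) as E. unfold Rsqr in E.
replace (X t s ^ 2 + Y t s ^ 2) with
  ((1 - t) ^ 2 * (a ^ 2 + b ^ 2) + 2 * ((1 - t) * t) * (r * (a * cos s + b * sin s)) +
   t ^ 2 * (r ^ 2 * (sin s * sin s + cos s * cos s))) by (unfold X, Y; ring).
rewrite E. pose proof (inner_abs s) as C.
assert (K : (1 - t) * t * (a * cos s + b * sin s) <= Rabs (1 - t) * Rabs t * r).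
{ eapply Rle_trans; [apply Rle_abs|]. rewrite !Rabs_mult.
  apply Rmult_le_compat_l; [|lra]. apply Rmult_le_pos; apply Rabs_pos. }
rewrite <- (pow2_abs (1 - t)), <- (pow2_abs t).
pose proof (Rabs_pos (1 - t)) as P1. pose proof (Rabs_pos t) as P2.
set (u := Rabs (1 - t)) in *. set (v := Rabs t) in *.
assert (B1 : u ^ 2 * (a ^ 2 + b ^ 2) <= u ^ 2 * r ^ 2) by (apply Rmult_le_compat_l; [apply pow2_ge_0|lra]).
assert (B2 : ((u + v) * r) ^ 2 < 1).
{ assert (0 <= (u + v) * r) by (apply Rmult_le_pos; lra). nra. }
nra.
Qed.

Lemma in_disk_near (t : R) : 0 <= t <= 1 ->
  locally t (fun t' => (Rabs (1 - t') + Rabs t') * r < 1).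
Proof.
intros Ht.
assert (P : 0 < (1 - r) / 2) by lra.
exists (mkposreal _ P). intros t' Hb.
unfold ball in Hb; simpl in Hb; unfold AbsRing_ball, abs, minus, plus, opp in Hb; simpl in Hb.
apply Rabs_lt_between in Hb.
assert (B : Rabs (1 - t') + Rabs t' <= 1 + (1 - r)).
{ unfold Rabs; destruct (Rcase_abs (1 - t')), (Rcase_abs t'); lra. }
nra.
Qed.

(** The chain rule yields F'(z_t) (z - c), and the kernel z / (z - c) cancels z - c. *)
Lemma is_derive_G (t s : R) : (Rabs (1 - t) + Rabs t) * r < 1 ->
  is_derive (fun t => G t s) t (dG t s).
Proof.
intros H. pose proof (den_pos s) as D.
assert (HX : is_derive (fun t => X t s) t (r * cos s - a)).
{ unfold X. auto_derive; [easy|ring]. }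
assert (HY : is_derive (fun t => Y t s) t (r * sin s - b)).
{ unfold Y. auto_derive; [easy|ring]. }
assert (HU := is_derive_along_U (fun t => X t s) (fun t => Y t s) t _ _ (in_disk t s H) HX HY).
assert (HV := is_derive_along_V (fun t => X t s) (fun t => Y t s) t _ _ (in_disk t s H) HX HY).
assert (HG := is_derive_minus _ _ _ _ _ (is_derive_scal_l _ _ _ (k1 s) HU) (is_derive_scal_l _ _ _ (k2 s) HV)).
cbn beta in HG.
(* [E1] and [E2] are the real and imaginary parts of (k1 + i k2) (z - c) = z. *)
assert (E1 : k1 s * (r * cos s - a) - k2 s * (r * sin s - b) = r * cos s).
{ pose proof (sin2_cos2 s) as E. unfold Rsqr in E.
  apply Rmult_eq_reg_l with (den s); [|lra].
  transitivity ((r ^ 2 - r * (a * cos s + b * sin s)) * (r * cos s - a)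
    - r * (b * cos s - a * sin s) * (r * sin s - b)); [unfold k1, k2; field; lra|].
  unfold den. ring_simplify. replace (sin s ^ 2) with (1 - cos s ^ 2) by (simpl; lra). ring. }
assert (E2 : k1 s * (r * sin s - b) + k2 s * (r * cos s - a) = r * sin s).
{ pose proof (sin2_cos2 s) as E. unfold Rsqr in E.
  apply Rmult_eq_reg_l with (den s); [|lra].
  transitivity ((r ^ 2 - r * (a * cos s + b * sin s)) * (r * sin s - b)
    + r * (b * cos s - a * sin s) * (r * cos s - a)); [unfold k1, k2; field; lra|].
  unfold den. ring_simplify. replace (cos s ^ 2) with (1 - sin s ^ 2) by (simpl; lra). ring. }
replace (dG t s) with (minus (scal (Ux (X t s) (Y t s) * (r * cos s - a) + - Vx (X t s) (Y t s) * (r * sin s - b)) (k1 s))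
   (scal (Vx (X t s) (Y t s) * (r * cos s - a) + Ux (X t s) (Y t s) * (r * sin s - b)) (k2 s))).
- exact HG.
- change (minus ?u ?v) with (u - v). change (scal ?u ?v) with (u * v).
  unfold dG. real_eq.
  transitivity (Ux (X t s) (Y t s) * (k1 s * (r * cos s - a) - k2 s * (r * sin s - b))
    - Vx (X t s) (Y t s) * (k1 s * (r * sin s - b) + k2 s * (r * cos s - a))); [ring|].
  now rewrite E1, E2.
Qed.

Lemma continuity_dG (t s : R) : (Rabs (1 - t) + Rabs t) * r < 1 -> continuity_2d_pt dG t s.
Proof.
intros H.
assert (CX : continuity_2d_pt X t s).
{ apply continuity_2d_pt_plus; [apply continuity_2d_pt_const|].
  apply continuity_2d_pt_mult; [apply continuity_2d_pt_id1|].
  apply (continuity_2d_pt_snd (fun v => r * cos v - a)).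
  apply (ex_derive_continuous (V := R_NormedModule)); auto_derive; easy. }
assert (CY : continuity_2d_pt Y t s).
{ apply continuity_2d_pt_plus; [apply continuity_2d_pt_const|].
  apply continuity_2d_pt_mult; [apply continuity_2d_pt_id1|].
  apply (continuity_2d_pt_snd (fun v => r * sin v - b)).
  apply (ex_derive_continuous (V := R_NormedModule)); auto_derive; easy. }
pose proof (in_disk t s H) as D.
apply continuity_2d_pt_minus; apply continuity_2d_pt_mult.
- apply continuity_2d_pt_comp2; auto.
- apply (continuity_2d_pt_snd (fun v => r * cos v)).
  apply (ex_derive_continuous (V := R_NormedModule)); auto_derive; easy.
- apply continuity_2d_pt_comp2; auto.
- apply (continuity_2d_pt_snd (fun v => r * sin v)).
  apply (ex_derive_continuous (V := R_NormedModule)); auto_derive; easy.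
Qed.

Lemma ex_RInt_G (t : R) : (Rabs (1 - t) + Rabs t) * r < 1 -> ex_RInt (G t) 0 (2 * PI).
Proof.
intros H. apply (ex_RInt_continuous (V := R_CompleteNormedModule)). intros s _.
pose proof (in_disk t s H) as D. pose proof (den_pos s) as Dp.
assert (HX : is_derive (X t) s (- t * r * sin s)).
{ unfold X. auto_derive; [easy|ring]. }
assert (HY : is_derive (Y t) s (t * r * cos s)).
{ unfold Y. auto_derive; [easy|ring]. }
assert (HU := is_derive_along_U (X t) (Y t) s _ _ D HX HY).
assert (HV := is_derive_along_V (X t) (Y t) s _ _ D HX HY).
apply (continuous_minus (V := R_NormedModule)
  (fun s => U (X t s) (Y t s) * k1 s) (fun s => V (X t s) (Y t s) * k2 s)); apply continuous_Rmult.
- apply (ex_derive_continuous (V := R_NormedModule)); eexists; exact HU.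
- apply (ex_derive_continuous (V := R_NormedModule)). unfold k1, den. auto_derive.
  revert Dp; unfold den, Rminus; simpl; lra.
- apply (ex_derive_continuous (V := R_NormedModule)); eexists; exact HV.
- apply (ex_derive_continuous (V := R_NormedModule)). unfold k2, den. auto_derive.
  revert Dp; unfold den, Rminus; simpl; lra.
Qed.

(* [t * dG t] is the derivative of [V] along the circle [s |-> (X t s, Y t s)]. *)
Lemma is_RInt_dG (t : R) : 0 <= t <= 1 -> is_RInt (dG t) 0 (2 * PI) 0.
Proof.
intros Ht.
assert (H : (Rabs (1 - t) + Rabs t) * r < 1) by (apply (locally_singleton _ _ (in_disk_near t Ht))).
assert (C : forall s, continuous (dG t) s) by (intros s; apply continuous_of_2d, continuity_dG, H).
destruct (Req_dec t 0) as [->|T].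
(* At t = 0 the curve is the point c, and [dG] is a trigonometric polynomial without constant
   term. *)
- set (F s := r * (Ux a b * sin s + Vx a b * cos s)).
  replace 0 with (F (2 * PI) - F 0) at 3
    by (unfold F; rewrite sin_2PI, cos_2PI, sin_0, cos_0; ring).
  apply (is_RInt_derive (V := R_CompleteNormedModule) F (dG 0)); [|intros; apply C].
  intros s _. unfold F, dG, X, Y. auto_derive; [easy|].
  replace (a + 0 * (r * cos s - a)) with a by ring.
  replace (b + 0 * (r * sin s - b)) with b by ring.
  real_eq. ring.
- set (F s := / t * V (X t s) (Y t s)).
  replace 0 with (F (2 * PI) - F 0) at 2
    by (unfold F, X, Y; rewrite sin_2PI, cos_2PI, sin_0, cos_0; ring).
  apply (is_RInt_derive (V := R_CompleteNormedModule) F (dG t)); [|intros; apply C].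
  intros s _.
  assert (HX : is_derive (X t) s (- t * r * sin s)).
  { unfold X. auto_derive; [easy|ring]. }
  assert (HY : is_derive (Y t) s (t * r * cos s)).
  { unfold Y. auto_derive; [easy|ring]. }
  assert (HV := is_derive_along_V (X t) (Y t) s _ _ (in_disk t s H) HX HY).
  replace (dG t s) with (/ t * (Vx (X t s) (Y t s) * (- t * r * sin s) + Ux (X t s) (Y t s) * (t * r * cos s))).
  + apply (is_derive_scal _ _ (/ t) _ HV).
  + unfold dG. real_eq. field; easy.
Qed.

(** The t-derivative of the integral is the integral of [dG], which vanishes. At t = 1 this is the
    Cauchy integral over the circle; at t = 0, F is frozen at c. *)
Lemma RInt_homotopy : RInt (G 1) 0 (2 * PI) = RInt (G 0) 0 (2 * PI).
Proof.
symmetry. apply (eq_is_derive (V := R_NormedModule) (fun t => RInt (G t) 0 (2 * PI))); [|lra].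
intros t Ht. pose proof (in_disk_near t Ht) as N.
assert (H : (Rabs (1 - t) + Rabs t) * r < 1) by (apply (locally_singleton _ _ N)).
match goal with |- is_derive _ _ ?z =>
  replace z with (RInt (fun s => Derive (fun t => G t s) t) 0 (2 * PI)) end.
- apply is_derive_RInt_param.
  + revert N; apply filter_imp. intros t' H' s _. eexists; apply is_derive_G, H'.
  + intros s _. apply continuity_2d_pt_ext_loc with (2 := continuity_dG t s H).
    destruct N as [d Hd]. exists d. intros u v Hu _.
    symmetry. apply is_derive_unique, is_derive_G, Hd, Hu.
  + revert N; apply filter_imp. intros t' H'. apply ex_RInt_G, H'.
- apply (is_RInt_unique (V := R_CompleteNormedModule)).
  apply (is_RInt_ext (dG t)); [|apply is_RInt_dG, Ht].
  intros s _. symmetry. apply is_derive_unique, is_derive_G, H.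
Qed.

End Homotopy.

Lemma continuous_circle (r : R) : 0 < r < 1 ->
  (forall t : R, continuous (fun t => U (r * cos t) (r * sin t)) t) /\
  (forall t : R, continuous (fun t => V (r * cos t) (r * sin t)) t).
Proof.
intros Hr.
assert (DX : forall t, is_derive (fun t => r * cos t) t (- r * sin t))
  by (intros t; auto_derive; [easy|ring]).
assert (DY : forall t, is_derive (fun t => r * sin t) t (r * cos t))
  by (intros t; auto_derive; [easy|ring]).
assert (D : forall t, (r * cos t) ^ 2 + (r * sin t) ^ 2 < 1).
{ intros t. pose proof (sin2_cos2 t) as E. unfold Rsqr in E.
  replace (_ + _) with (r ^ 2 * (sin t * sin t + cos t * cos t)) by ring. rewrite E. nra. }
split; intros t; apply (ex_derive_continuous (V := R_NormedModule)); eexists.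
- apply (is_derive_along_U (fun t => r * cos t) (fun t => r * sin t) t _ _ (D t) (DX t) (DY t)).
- apply (is_derive_along_V (fun t => r * cos t) (fun t => r * sin t) t _ _ (D t) (DX t) (DY t)).
Qed.

(** For u = U and v = V, the real part of the n-th Taylor coefficient of F, by Cauchy's formula. The
    choice u = V and v = -U, that is -i F, gives the imaginary part. *)
Definition taylor_coeff (u v : R -> R -> R) (r : R) (n : nat) : R :=
  / (2 * PI * r ^ n) *
  RInt (fun t => u (r * cos t) (r * sin t) * cos (INR n * t)
               + v (r * cos t) (r * sin t) * sin (INR n * t)) 0 (2 * PI).

Lemma is_series_taylor_real (r s x : R) : 0 < r < 1 -> 0 <= s < r ->
  is_series (fun n => s ^ n *
      (taylor_coeff U V r n * cos (INR n * x)
       - taylor_coeff V (fun a b => - U a b) r n * sin (INR n * x)))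
    (U (s * cos x) (s * sin x)).
Proof.
intros Hr Hs. pose proof PI_RGT_0 as PI0.
set (g t := U (r * cos t) (r * sin t)). set (h t := V (r * cos t) (r * sin t)).
destruct (continuous_circle r Hr) as [Cg Ch]. fold g in Cg. fold h in Ch.
set (a := s * cos x). set (b := s * sin x). set (q := s / r).
assert (Ex := sin2_cos2 x). unfold Rsqr in Ex.
assert (Hab : a ^ 2 + b ^ 2 < r ^ 2).
{ unfold a, b. replace (_ + _) with (s ^ 2 * (sin x * sin x + cos x * cos x)) by ring.
  rewrite Ex. nra. }
assert (Hq : 0 <= q < 1).
{ unfold q; split; [apply Rdiv_le_0_compat; lra|apply Rlt_div_l; lra]. }
(* With c = s exp(i x) and q = s / r, the kernel z / (z - c) is 1 / (1 - q exp(i (x - t))). [S1]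
   expands the Cauchy integral of F, and [S0] that of the constant F(c). *)
assert (S1 := is_series_cauchy_kernel g h q x Hq Cg Ch).
assert (S0 := is_series_cauchy_kernel (fun _ => U a b) (fun _ => V a b) q x Hq
  (fun t => continuous_const _ t) (fun t => continuous_const _ t)).
assert (E := RInt_homotopy r a b Hr Hab). cbv beta zeta in E.
assert (Kc : forall t, a * cos t + b * sin t = s * cos (t - x)).
{ intros t. rewrite cos_minus. unfold a, b. ring. }
assert (Ks : forall t, b * cos t - a * sin t = - s * sin (t - x)).
{ intros t. rewrite sin_minus. unfold a, b. ring. }
assert (Kd : a ^ 2 + b ^ 2 = s ^ 2).
{ unfold a, b. replace (_ + _) with (s ^ 2 * (sin x * sin x + cos x * cos x)) by ring.
  rewrite Ex. ring. }
assert (Kpos : forall t, 0 < 1 - 2 * q * cos (t - x) + q ^ 2).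
{ intros t. apply Rlt_le_trans with ((1 - q) ^ 2); [apply pow_lt; lra|now apply poisson_denom_ge]. }
assert (K : forall u v t, u * ((r ^ 2 - r * (a * cos t + b * sin t)) /
      (r ^ 2 - 2 * r * (a * cos t + b * sin t) + (a ^ 2 + b ^ 2)))
    - v * (r * (b * cos t - a * sin t) /
      (r ^ 2 - 2 * r * (a * cos t + b * sin t) + (a ^ 2 + b ^ 2)))
    = (u * (1 - q * cos (t - x)) + v * (q * sin (t - x))) / (1 - 2 * q * cos (t - x) + q ^ 2)).
{ intros u v t. rewrite Kc, Ks, Kd. replace s with (q * r) by (unfold q; field; lra).
  specialize (Kpos t).
  replace (r ^ 2 - 2 * r * (q * r * cos (t - x)) + (q * r) ^ 2)
    with (r ^ 2 * (1 - 2 * q * cos (t - x) + q ^ 2)) by ring.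
  field. lra. }
rewrite (RInt_ext _ (fun t => (g t * (1 - q * cos (t - x)) + h t * (q * sin (t - x)))
   / (1 - 2 * q * cos (t - x) + q ^ 2))) in E.
2: { intros t _. rewrite <- K. unfold g, h.
     replace (a + 1 * (r * cos t - a)) with (r * cos t) by ring.
     replace (b + 1 * (r * sin t - b)) with (r * sin t) by ring. reflexivity. }
rewrite E in S1. clear E.
rewrite (RInt_ext _ (fun t => (U a b * (1 - q * cos (t - x)) + V a b * (q * sin (t - x)))
   / (1 - 2 * q * cos (t - x) + q ^ 2))) in S1.
2: { intros t _. rewrite <- K.
     replace (a + 0 * (r * cos t - a)) with a by ring.
     replace (b + 0 * (r * sin t - b)) with b by ring. reflexivity. }
(* In [S0] only the term n = 0 survives, with value 2 pi U(c). *)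
assert (V0 : RInt (fun t => (U a b * (1 - q * cos (t - x)) + V a b * (q * sin (t - x)))
   / (1 - 2 * q * cos (t - x) + q ^ 2)) 0 (2 * PI) = 2 * PI * U a b).
{ rewrite <- (is_series_unique _ _ S0). apply is_series_unique.
  refine (is_series_ext _ _ _ _ (is_series_single (2 * PI * U a b) 0)). intros n.
    assert (I := is_RInt_trig_mul (U a b * cos (INR n * x) - V a b * sin (INR n * x))
       (U a b * sin (INR n * x) + V a b * cos (INR n * x)) 0 n 0).
    rewrite (is_RInt_unique (V := R_CompleteNormedModule) _ _ _
      (if Nat.eq_dec n 0 then 2 * PI * U a b else 0)).
    + real_eq.
      destruct (Nat.eq_dec n 0) as [->|_]; simpl; ring.
    + match type of I with is_RInt _ _ _ ?v =>
        assert (Ev : v = if Nat.eq_dec n 0 then 2 * PI * U a b else 0) end.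
      { destruct (Nat.eq_dec n 0) as [->|_]; [|easy].
        change (INR 0) with 0. rewrite !Rmult_0_l, cos_0, sin_0. real_eq. ring. }
      rewrite Ev in I. refine (is_RInt_ext _ _ _ _ _ _ I). intros t _.
      real_eq.
      replace (INR n * (t - x)) with (INR n * t - INR n * x) by ring.
      change (INR 0) with 0. rewrite Rmult_0_l, cos_0, cos_minus, sin_minus. ring. }
rewrite V0 in S1.
replace (U a b) with (/ (2 * PI) * (2 * PI * U a b)) by (field; lra).
apply (is_series_ext) with (2 := is_series_scal_l (/ (2 * PI)) _ _ S1).
intros n. change (scal ?u ?v) with (u * v).
real_eq.
assert (ex : forall (c d : R -> R), (forall t, continuous c t) -> (forall t, continuous d t) ->
  ex_RInt (fun t => g t * c t + h t * d t) 0 (2 * PI)).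
{ intros c d Cc Cd. apply (ex_RInt_continuous (V := R_CompleteNormedModule)).
  intros t _. apply continuous_Rplus; apply continuous_Rmult; easy. }
assert (Cc : forall t, continuous (fun t => cos (INR n * t)) t).
{ intros t. apply (ex_derive_continuous (V := R_NormedModule)); auto_derive; easy. }
assert (Cs : forall t, continuous (fun t => sin (INR n * t)) t).
{ intros t. apply (ex_derive_continuous (V := R_NormedModule)); auto_derive; easy. }
assert (Cs' : forall t, continuous (fun t => - sin (INR n * t)) t).
{ intros t. apply (ex_derive_continuous (V := R_NormedModule)); auto_derive; easy. }
assert (I1 := RInt_correct (V := R_CompleteNormedModule) _ _ _ (ex _ _ Cc Cs)).
assert (I2 := RInt_correct (V := R_CompleteNormedModule) _ _ _ (ex _ _ Cs' Cc)).
assert (I := is_RInt_minus _ _ _ _ _ _ (is_RInt_scal _ _ _ (cos (INR n * x)) _ I1)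
  (is_RInt_scal _ _ _ (sin (INR n * x)) _ I2)).
rewrite (is_RInt_unique (V := R_CompleteNormedModule) _ _ _
  (cos (INR n * x) * RInt (fun t => g t * cos (INR n * t) + h t * sin (INR n * t)) 0 (2 * PI) -
   sin (INR n * x) * RInt (fun t => g t * - sin (INR n * t) + h t * cos (INR n * t)) 0 (2 * PI))).
2: { apply (is_RInt_ext _ _ _ _ _) with (2 := I). intros t _.
     change (minus ?u ?v) with (u - v). change (scal ?u ?v) with (u * v).
     real_eq.
     replace (INR n * (t - x)) with (INR n * t - INR n * x) by ring.
     rewrite cos_minus, sin_minus. ring. }
unfold taylor_coeff. fold g h.
rewrite (RInt_ext (fun t => V _ _ * _ + _) (fun t => g t * - sin (INR n * t) + h t * cos (INR n * t))).
2: { intros t _. unfold g, h. real_eq. ring. }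
unfold g, h. unfold q. unfold Rdiv. rewrite Rpow_mult_distr, pow_inv.
field. repeat split; try lra; apply pow_nonzero; lra.
Qed.

End CauchyRiemann.

(** The series of V is that of the real part of -i F = V - i U. The coefficients may depend on r at
    this stage; uniqueness on the real axis removes the dependence later. *)
Lemma is_series_taylor (U V Ux Vx : R -> R -> R) :
  (forall x y, x ^ 2 + y ^ 2 < 1 -> is_derive (fun z => U z y) x (Ux x y)) ->
  (forall x y, x ^ 2 + y ^ 2 < 1 -> is_derive (fun z => U x z) y (- Vx x y)) ->
  (forall x y, x ^ 2 + y ^ 2 < 1 -> is_derive (fun z => V z y) x (Vx x y)) ->
  (forall x y, x ^ 2 + y ^ 2 < 1 -> is_derive (fun z => V x z) y (Ux x y)) ->
  (forall x y, x ^ 2 + y ^ 2 < 1 -> continuity_2d_pt Ux x y) ->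
  (forall x y, x ^ 2 + y ^ 2 < 1 -> continuity_2d_pt Vx x y) ->
  exists A A' : R -> nat -> R, forall r s x, 0 < r < 1 -> 0 <= s < r ->
    is_series (fun n => s ^ n * (A r n * cos (INR n * x) - A' r n * sin (INR n * x)))
      (U (s * cos x) (s * sin x)) /\
    is_series (fun n => s ^ n * (A' r n * cos (INR n * x) + A r n * sin (INR n * x)))
      (V (s * cos x) (s * sin x)).
Proof.
intros HUx HUy HVx HVy CUx CVx.
exists (taylor_coeff U V), (taylor_coeff V (fun a b => - U a b)).
intros r s x Hr Hs. split.
- apply (is_series_taylor_real U V Ux Vx); auto.
- refine (is_series_ext _ _ _ _ (is_series_taylor_real V (fun a b => - U a b) Vx
    (fun a b => - Ux a b) _ _ _ _ _ _ r s x Hr Hs)); auto.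
  (* The sine coefficient comes from the pair (-U, -V), hence is minus that of (U, V). *)
  + intros n. real_eq.
    f_equal. unfold Rminus. f_equal. rewrite Ropp_mult_distr_l. f_equal.
    unfold taylor_coeff. rewrite Ropp_mult_distr_r. f_equal.
    destruct (continuous_circle U V Ux Vx HUx HUy HVx HVy CUx CVx r Hr) as [Cg Ch].
    set (k t := U (r * cos t) (r * sin t) * cos (INR n * t)
      + V (r * cos t) (r * sin t) * sin (INR n * t)).
    assert (E : RInt (fun t => opp (k t)) 0 (2 * PI) = - RInt k 0 (2 * PI)).
    { apply (RInt_opp (V := R_CompleteNormedModule) k).
      apply (ex_RInt_continuous (V := R_CompleteNormedModule)). intros t _.
      apply continuous_Rplus; apply continuous_Rmult; try easy;
        apply (ex_derive_continuous (V := R_NormedModule)); auto_derive; easy. }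
    rewrite <- (Ropp_involutive (RInt k _ _)), <- E. f_equal.
    apply RInt_ext. intros t _. change (opp ?u) with (- u). unfold k.
    real_eq. ring.
  + intros u v H. rewrite Ropp_involutive. now apply HVy.
  + intros u v H. apply (is_derive_opp (fun z => U z v)), HUx, H.
  + intros u v H. replace (Vx u v) with (opp (- Vx u v)) by (apply Ropp_involutive).
    apply (is_derive_opp (fun z => U u z)), HUy, H.
  + intros u v H. apply continuity_2d_pt_opp, CUx, H.
Qed.

(** * Slices and power expansions *)

Lemma oip_omul_skew (p v e : oct) :
  oip (omul p v) e + oip v (omul p e) = 2 * ore p * oip v e.
Proof. oct_ring. Qed.

(** Norms in I I = -1 give |I| = 1; real parts give 2 (Re I)^2 - |I|^2 = -1, so Re I = 0. *)
Lemma imag_unit_spec (I : oct) : imag_unit I -> ore I = 0 /\ oip I I = 1.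
Proof.
intros H. unfold imag_unit in H.
assert (N : oip I I * oip I I = 1).
{ rewrite <- oip_omul, H. oct_ring. }
assert (R : 2 * (ore I * ore I) - oip I I = -1).
{ transitivity (ore (omul I I)); [oct_ring|]. rewrite H. reflexivity. }
pose proof (oip_ge_0 I). assert (oip I I = 1) by nra. split; nra.
Qed.

Lemma imag_unit_of_spec (I : oct) : ore I = 0 -> oip I I = 1 -> imag_unit I.
Proof.
intros H1 H2. unfold imag_unit.
(* Every octonion satisfies x^2 = 2 Re(x) x - |x|^2. *)
transitivity (plus (scal (2 * ore I) I) (oreal (- oip I I))); [oct_ring|].
rewrite H1, H2. oct_ring.
Qed.

(** With [omul_imag_twice], this makes left multiplication by I a complex structure for which p |->
    <p, e> + i <p, I e> is complex linear. *)
Lemma oip_imag_skew (I v e : oct) : imag_unit I -> oip (omul I v) e = - oip v (omul I e).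
Proof.
intros H. destruct (imag_unit_spec I H) as [R _].
pose proof (oip_omul_skew I v e) as S. rewrite R in S. lra.
Qed.

Lemma omul_imag_twice (I v : oct) : imag_unit I -> omul I (omul I v) = opp v.
Proof. intros H. rewrite omul_alt, H. oct_ring. Qed.

Lemma oip_slice_pt (I : oct) (x y : R) : imag_unit I ->
  oip (slice_pt I x y) (slice_pt I x y) = x ^ 2 + y ^ 2.
Proof.
intros H. destruct (imag_unit_spec I H) as [R N].
transitivity (x ^ 2 + 2 * x * y * ore I + y ^ 2 * oip I I); [oct_ring|].
rewrite R, N; ring.
Qed.

Lemma norm_slice_pt_polar (I : oct) (s x : R) : imag_unit I -> 0 <= s ->
  norm (slice_pt I (s * cos x) (s * sin x)) = s.
Proof.
intros HI Hs. rewrite norm_oip, oip_slice_pt by easy.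
pose proof (sin2_cos2 x) as E. unfold Rsqr in E.
replace (_ + _) with (s * s * (sin x * sin x + cos x * cos x)) by ring.
rewrite E, Rmult_1_r. now apply sqrt_square.
Qed.

Lemma norm_slice_conj (I : oct) (x : R) : imag_unit I -> norm (slice_pt I (cos x) (- sin x)) = 1.
Proof.
intros HI. rewrite norm_oip, oip_slice_pt by easy.
pose proof (sin2_cos2 x) as E. unfold Rsqr in E.
replace (_ + _) with 1 by (simpl; lra). apply sqrt_1.
Qed.

Lemma oball_slice_pt (I : oct) (x y : R) : imag_unit I ->
  x ^ 2 + y ^ 2 < 1 -> oball (slice_pt I x y).
Proof.
intros H L. unfold oball. rewrite norm_oip, oip_slice_pt by easy.
rewrite <- sqrt_1. apply sqrt_lt_1_alt. split; [|easy].
pose proof (pow2_ge_0 x). pose proof (pow2_ge_0 y). lra.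
Qed.

Lemma omul_slice_pt (I : oct) (a b c d : R) : imag_unit I ->
  omul (slice_pt I a b) (slice_pt I c d) = slice_pt I (a * c - b * d) (a * d + b * c).
Proof.
intros H.
transitivity (plus (plus (oreal (a * c)) (scal (a * d + b * c) I)) (scal (b * d) (omul I I)));
  [oct_ring|].
rewrite H. oct_ring.
Qed.

(** Left alternativity is enough associativity here: both factors lie on one slice, while p is
    arbitrary. *)
Lemma omul_slice_twice (I p : oct) (a b c d : R) : imag_unit I ->
  omul (slice_pt I a b) (omul (slice_pt I c d) p) =
  omul (slice_pt I (a * c - b * d) (a * d + b * c)) p.
Proof.
intros H. rewrite !omul_slice, omul_plus_r, !omul_scal_r, omul_imag_twice by easy.
generalize (omul I p). clear. oct_ring.
Qed.

Lemma opow_polar (I : oct) (s x : R) (n : nat) : imag_unit I ->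
  opow (slice_pt I (s * cos x) (s * sin x)) n =
  slice_pt I (s ^ n * cos (INR n * x)) (s ^ n * sin (INR n * x)).
Proof.
intros H. induction n as [|n IH].
- simpl. rewrite Rmult_0_l, cos_0, sin_0. oct_ring.
- change (opow ?w (S n)) with (omul w (opow w n)). rewrite IH, omul_slice_pt by easy.
  rewrite S_INR. replace ((INR n + 1) * x) with (x + INR n * x) by ring.
  rewrite cos_plus, sin_plus. f_equal; simpl; ring.
Qed.

Lemma opow_real (z : R) (n : nat) : opow (oreal z) n = oreal (z ^ n).
Proof.
induction n as [|n IH]; [easy|].
change (opow ?w (S n)) with (omul w (opow w n)). rewrite IH. simpl pow. oct_ring.
Qed.

Lemma norm_opow (w : oct) (n : nat) : norm (opow w n) = norm w ^ n.
Proof.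
induction n as [|n IH].
- simpl. rewrite norm_oreal. apply Rabs_R1.
- change (opow ?w (S n)) with (omul w (opow w n)). rewrite norm_omul, IH. easy.
Qed.

(** On one slice and along e, a power expansion thereby becomes a real trigonometric series. *)
Lemma oip_opow_polar (I : oct) (s x : R) (n : nat) (b e : oct) : imag_unit I ->
  oip (omul (opow (slice_pt I (s * cos x) (s * sin x)) n) b) e =
  s ^ n * (oip b e * cos (INR n * x) + oip (omul I b) e * sin (INR n * x)).
Proof.
intros H. rewrite opow_polar, omul_slice, oip_plus_l, !oip_scal_l by easy. ring.
Qed.

Lemma imag_unit_slice_unit (w : oct) : imag_unit (slice_unit w).
Proof.
unfold slice_unit. destruct (excluded_middle_informative _) as [_|N].
- unfold imag_unit. oct_ring.
- assert (P : 0 < oip (oim w) (oim w)).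
  { destruct (oip_ge_0 (oim w)) as [P|P]; [easy|]. exfalso; apply N, oip_eq_0; easy. }
  apply imag_unit_of_spec.
  + transitivity (/ norm (oim w) * ore (oim w)); [generalize (/ norm (oim w)); oct_ring|].
    replace (ore (oim w)) with 0 by oct_ring. ring.
  + rewrite oip_scal_l, oip_sym, oip_scal_l.
    assert (norm (oim w) * norm (oim w) <> 0) by (rewrite norm_oip_sqr; lra).
    rewrite <- norm_oip_sqr. field. intros Z; apply H; rewrite Z; ring.
Qed.

Lemma slice_pt_slice_unit (w : oct) : w = slice_pt (slice_unit w) (ore w) (norm (oim w)).
Proof.
unfold slice_unit. destruct (excluded_middle_informative _) as [E|N].
- rewrite E. replace (norm ozero) with 0 by (rewrite norm_oip, oip_zero_l; now rewrite sqrt_0).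
  transitivity (plus (oreal (ore w)) (oim w)); [oct_ring|]. rewrite E. oct_ring.
- assert (P : norm (oim w) <> 0).
  { intros Z. apply N, oip_eq_0. rewrite <- norm_oip_sqr, Z. ring. }
  transitivity (plus (oreal (ore w)) (scal (norm (oim w) * / norm (oim w)) (oim w))).
  + rewrite Rinv_r by easy. oct_ring.
  + generalize (norm (oim w)) (/ norm (oim w)). oct_ring.
Qed.

Lemma oct_polar (w : oct) : exists I x, imag_unit I /\
  w = slice_pt I (norm w * cos x) (norm w * sin x).
Proof.
exists (slice_unit w).
assert (E : norm w * norm w = ore w * ore w + norm (oim w) * norm (oim w)).
{ rewrite !norm_oip_sqr. oct_ring. }
pose proof (norm_ge_0 w) as P. pose proof (norm_ge_0 (oim w)) as Q.
destruct (Req_dec (norm w) 0) as [Z|Z].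
- exists 0. split; [apply imag_unit_slice_unit|].
  rewrite Z in E |- *. rewrite (slice_pt_slice_unit w) at 1.
  f_equal; nra.
(* The coefficient of the slice unit is a norm, hence nonnegative, so the angle lies in [0, pi]. *)
- exists (acos (ore w / norm w)). split; [apply imag_unit_slice_unit|].
  assert (B : -1 <= ore w / norm w <= 1).
  { split; [apply Rle_div_r|apply Rle_div_l]; nra. }
  rewrite cos_acos, sin_acos by easy.
  rewrite (slice_pt_slice_unit w) at 1. f_equal; [field; easy|].
  rewrite <- (sqrt_square (norm w)) at 1 by easy. rewrite <- sqrt_mult; [|nra|].
  + rewrite <- (sqrt_square (norm (oim w))) by easy. f_equal.
    unfold Rsqr. apply Rmult_eq_reg_r with (norm w * norm w); [|nra].
    transitivity (norm w * norm w * (norm w * norm w - ore w * ore w)); [rewrite E; ring|field; easy].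
  + unfold Rsqr. nra.
Qed.

(** Riesz representation, used to assemble an octonion from real data linear in e: sums of series
    and power series coefficients. *)
Lemma oip_representation (L : oct -> R) :
  (forall p q, L (plus p q) = L p + L q) -> (forall c p, L (scal c p) = c * L p) ->
  exists v, forall e, L e = oip v e.
Proof.
intros Lp Ls.
set (e0 := (((1, 0), (0, 0)), ((0, 0), (0, 0))) : oct).
set (e1 := (((0, 1), (0, 0)), ((0, 0), (0, 0))) : oct).
set (e2 := (((0, 0), (1, 0)), ((0, 0), (0, 0))) : oct).
set (e3 := (((0, 0), (0, 1)), ((0, 0), (0, 0))) : oct).
set (e4 := (((0, 0), (0, 0)), ((1, 0), (0, 0))) : oct).
set (e5 := (((0, 0), (0, 0)), ((0, 1), (0, 0))) : oct).
set (e6 := (((0, 0), (0, 0)), ((0, 0), (1, 0))) : oct).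
set (e7 := (((0, 0), (0, 0)), ((0, 0), (0, 1))) : oct).
exists (((L e0, L e1), (L e2, L e3)), ((L e4, L e5), (L e6, L e7))).
intros [[[x0 x1] [x2 x3]] [[x4 x5] [x6 x7]]].
transitivity (L (plus (plus (plus (scal x0 e0) (scal x1 e1)) (plus (scal x2 e2) (scal x3 e3)))
   (plus (plus (scal x4 e4) (scal x5 e5)) (plus (scal x6 e6) (scal x7 e7))))).
- f_equal. unfold e0, e1, e2, e3, e4, e5, e6, e7. oct_ring.
- rewrite !Lp, !Ls. unfold oip. ring.
Qed.

Lemma ex_is_series_oct (b : nat -> oct) :
  (forall e, ex_series (fun n => oip (b n) e)) -> exists l, is_series b l.
Proof.
intros H.
destruct (oip_representation (fun e => Series (fun n => oip (b n) e))) as [v Hv].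
- intros p q. rewrite <- Series_plus by apply H. apply Series_ext. intros n.
  rewrite !(oip_sym (b n)). apply oip_plus_l.
- intros c p. rewrite <- Series_scal_l. apply Series_ext. intros n.
  rewrite !(oip_sym (b n)). apply oip_scal_l.
- exists v. apply is_series_oct. intros e. rewrite <- Hv. apply Series_correct, H.
Qed.

Lemma ex_is_series_oct_geom (b : nat -> oct) (c q : R) : 0 <= q < 1 ->
  (forall n, norm (b n) <= c * q ^ n) -> exists l, is_series b l.
Proof.
intros Hq H. apply ex_is_series_oct. intros e.
apply (ex_series_le (V := R_CompleteNormedModule) _ (fun n => norm e * (c * q ^ n))).
- intros n. eapply Rle_trans; [apply oip_le_norm|]. rewrite Rmult_comm.
  apply Rmult_le_compat_l; [apply norm_ge_0|apply H].
- apply (ex_series_scal_l (V := R_NormedModule)). apply (ex_series_scal_l (V := R_NormedModule)).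
  apply ex_series_geom. rewrite Rabs_pos_eq; lra.
Qed.

Lemma bounded_of_eventually (u : nat -> R) (c : R) (N : nat) :
  (forall n, (N <= n)%nat -> u n <= c) -> exists C, 0 <= C /\ forall n, u n <= C.
Proof.
revert c. induction N as [|N IH]; intros c H.
- exists (Rmax 0 c). split; [apply Rmax_l|]. intros n.
  eapply Rle_trans; [apply H; lia|apply Rmax_r].
- apply (IH (Rmax c (u N))). intros n L.
  destruct (Nat.eq_dec n N) as [->|D]; [apply Rmax_r|].
  eapply Rle_trans; [apply H; lia|apply Rmax_l].
Qed.

Lemma onorm_plus (p q : oct) : norm (plus p q) <= norm p + norm q.
Proof. exact (norm_triangle p q). Qed.

Lemma onorm_opp (p : oct) : norm (opp p) = norm p.
Proof. rewrite !norm_oip, oip_opp_l, oip_sym, oip_opp_l, Ropp_involutive. easy. Qed.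

Lemma onorm_minus (p q : oct) : norm (minus p q) <= norm p + norm q.
Proof.
replace (minus p q) with (plus p (opp q)) by oct_ring.
rewrite <- (onorm_opp q). apply onorm_plus.
Qed.

Lemma is_series_norm_bounded (b : nat -> oct) (l : oct) :
  is_series b l -> exists C, 0 <= C /\ forall n, norm (b n) <= C.
Proof.
intros H.
destruct (proj1 (filterlim_locally_ball_norm _ _) H (mkposreal 1 Rlt_0_1)) as [N HN].
apply bounded_of_eventually with (c := 2) (N := S N). intros n L.
destruct n as [|n]; [lia|].
assert (E : b (S n) = plus (minus (sum_n b (S n)) l) (opp (minus (sum_n b n) l))).
{ rewrite sum_Sn. generalize (sum_n b n : oct) (b (S n)). oct_ring. }
rewrite E. eapply Rle_trans; [apply onorm_plus|]. rewrite onorm_opp.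
pose proof (Rlt_le _ _ (HN n ltac:(lia))) as B1.
pose proof (Rlt_le _ _ (HN (S n) ltac:(lia))) as B2.
replace 2 with (1 + 1) by ring. apply Rplus_le_compat; [exact B2|exact B1].
Qed.

Lemma pseries_coeff_unique (a b : nat -> R) (F : R -> R) (r : R) (n : nat) : 0 < r ->
  (forall z, Rabs z < r -> is_series (fun n => a n * z ^ n) (F z)) ->
  (forall z, Rabs z < r -> is_series (fun n => b n * z ^ n) (F z)) -> a n = b n.
Proof.
intros Hr Ha Hb.
assert (CV : forall c, (forall z, Rabs z < r -> is_series (fun n => c n * z ^ n) (F z)) ->
  Rbar_lt 0 (CV_radius c)).
{ intros c Hc. apply Rbar_lt_le_trans with (Rabs (r / 2)); [simpl; apply Rabs_pos_lt; lra|].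
  apply Rbar_not_lt_le. intros D. apply CV_disk_outside in D. apply D.
  apply ex_series_lim_0. exists (F (r / 2)). apply Hc. rewrite Rabs_pos_eq; lra. }
apply PSeries_ext_recip; auto.
exists (mkposreal r Hr). intros z Hz.
assert (Z : Rabs z < r).
{ unfold ball in Hz; simpl in Hz; unfold AbsRing_ball, abs, minus, plus, opp in Hz; simpl in Hz.
  now rewrite Ropp_0, Rplus_0_r in Hz. }
transitivity (F z); [|symmetry]; apply is_pseries_unique, is_pseries_R; auto.
Qed.

(** * Power expansion of a slice regular function *)

Section SliceRegularExpansion.

Variable f : oct -> oct.
Hypothesis Hf : slice_regular oball f.

Lemma is_derive_slice_dx (I : oct) (x y : R) : imag_unit I -> x ^ 2 + y ^ 2 < 1 ->
  is_derive (fun t => f (slice_pt I t y)) x (slice_dx f I x y).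
Proof.
intros HI H. destruct (Hf I HI x y (oball_slice_pt I x y HI H)) as [E _].
exact (epsilon_spec (inhabits ozero) _ E).
Qed.

Lemma is_derive_slice_dy (I : oct) (x y : R) : imag_unit I -> x ^ 2 + y ^ 2 < 1 ->
  is_derive (fun t => f (slice_pt I x t)) y (slice_dy f I x y).
Proof.
intros HI H. destruct (Hf I HI x y (oball_slice_pt I x y HI H)) as (_ & E & _).
exact (epsilon_spec (inhabits ozero) _ E).
Qed.

(** The regularity equation is paired with I e, since <I p, I e> = <p, e>. *)
Lemma slice_cauchy_riemann (I e : oct) (x y : R) : imag_unit I -> x ^ 2 + y ^ 2 < 1 ->
  oip (slice_dy f I x y) e = - oip (slice_dx f I x y) (omul I e).
Proof.
intros HI H. destruct (Hf I HI x y (oball_slice_pt I x y HI H)) as (_ & _ & _ & _ & E).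
assert (Z : oip (scal (1 / 2) (plus (slice_dx f I x y) (omul I (slice_dy f I x y)))) (omul I e) = 0).
{ rewrite E. apply oip_zero_l. }
rewrite oip_scal_l, oip_plus_l, oip_imag_skew, omul_imag_twice in Z by easy.
rewrite (oip_sym _ (opp e)), oip_opp_l, (oip_sym e) in Z. lra.
Qed.

Lemma continuity_slice_dx (I e : oct) (x y : R) : imag_unit I -> x ^ 2 + y ^ 2 < 1 ->
  continuity_2d_pt (fun u v => oip (slice_dx f I u v) e) x y.
Proof.
intros HI H. destruct (Hf I HI x y (oball_slice_pt I x y HI H)) as (_ & _ & C & _).
apply continuity_2d_pt_filterlim.
apply (filterlim_comp _ _ _ _ (fun p : oct => oip p e) _ _ _ C).
apply (linear_cont (fun p : oct => oip p e)), is_linear_oip.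
Qed.

(** By [slice_cauchy_riemann], <f, e> + i <f, I e> is holomorphic on the slice. *)
Lemma slice_taylor (I e : oct) : imag_unit I ->
  exists A A' : R -> nat -> R, forall r s x, 0 < r < 1 -> 0 <= s < r ->
    is_series (fun n => s ^ n * (A r n * cos (INR n * x) - A' r n * sin (INR n * x)))
      (oip (f (slice_pt I (s * cos x) (s * sin x))) e) /\
    is_series (fun n => s ^ n * (A' r n * cos (INR n * x) + A r n * sin (INR n * x)))
      (oip (f (slice_pt I (s * cos x) (s * sin x))) (omul I e)).
Proof.
intros HI.
apply (is_series_taylor (fun x y => oip (f (slice_pt I x y)) e)
  (fun x y => oip (f (slice_pt I x y)) (omul I e))
  (fun x y => oip (slice_dx f I x y) e) (fun x y => oip (slice_dx f I x y) (omul I e)));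
  intros x y H.
- apply (is_derive_oip (fun t => f (slice_pt I t y))), is_derive_slice_dx; easy.
- rewrite <- slice_cauchy_riemann by easy.
  apply (is_derive_oip (fun t => f (slice_pt I x t))), is_derive_slice_dy; easy.
- apply (is_derive_oip (fun t => f (slice_pt I t y))), is_derive_slice_dx; easy.
- replace (oip (slice_dx f I x y) e) with (oip (slice_dy f I x y) (omul I e)).
  + apply (is_derive_oip (fun t => f (slice_pt I x t))), is_derive_slice_dy; easy.
  + rewrite slice_cauchy_riemann, omul_imag_twice, oip_sym, oip_opp_l, oip_sym by easy. ring.
- apply continuity_slice_dx; easy.
- apply continuity_slice_dx; easy.
Qed.

Lemma is_series_on_reals (A A' : nat -> R) (I e : oct) (r : R) :
  (forall s x, 0 <= s < r ->
    is_series (fun n => s ^ n * (A n * cos (INR n * x) - A' n * sin (INR n * x)))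
      (oip (f (slice_pt I (s * cos x) (s * sin x))) e)) ->
  forall z, Rabs z < r -> is_series (fun n => A n * z ^ n) (oip (f (oreal z)) e).
Proof.
intros H z Hz. destruct (Rle_lt_dec 0 z) as [P|P].
- assert (S := H z 0 ltac:(rewrite Rabs_pos_eq in Hz; lra)).
  replace (slice_pt I (z * cos 0) (z * sin 0)) with (oreal z) in S.
  2: { rewrite cos_0, sin_0. clear. generalize I. oct_ring. }
  revert S. apply is_series_ext. intros n. rewrite Rmult_0_r, cos_0, sin_0.
  real_eq. ring.
(* A negative z sits at angle pi, where cos(n pi) = (-1)^n restores its sign. *)
- assert (S := H (- z) PI ltac:(rewrite Rabs_left in Hz; lra)).
  replace (slice_pt I (- z * cos PI) (- z * sin PI)) with (oreal z) in S.
  2: { rewrite cos_PI, sin_PI. clear. generalize I. oct_ring. }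
  revert S. apply is_series_ext. intros n.
  destruct (cos_sin_INR_PI n) as [-> ->].
  real_eq.
  replace (z ^ n) with ((- z) ^ n * (-1) ^ n); [ring|].
  rewrite <- Rpow_mult_distr. f_equal; ring.
Qed.

(* The coefficients are those of the restriction to the real axis, which lies on
   every slice; hence one sequence serves all slices. *)
Lemma slice_regular_power_expansion : exists a, power_expansion f a.
Proof.
assert (Hi : imag_unit ounit_i) by (unfold imag_unit; oct_ring).
assert (X : forall e, exists al : nat -> R, forall z, Rabs z < 1 / 2 ->
  is_series (fun n => al n * z ^ n) (oip (f (oreal z)) e)).
{ intros e. destruct (slice_taylor ounit_i e Hi) as (A & A' & H).
  exists (A (1 / 2)). apply (is_series_on_reals (A (1/2)) (A' (1/2)) ounit_i).
  intros s x Hs. exact (proj1 (H (1 / 2) s x ltac:(lra) ltac:(lra))). }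
(* The coefficients of <f, e> on the real axis; the radius 1/2 is an arbitrary choice. *)
set (al e := epsilon (inhabits (fun _ : nat => 0)) (fun al : nat -> R => forall z, Rabs z < 1 / 2 ->
  is_series (fun n => al n * z ^ n) (oip (f (oreal z)) e))).
assert (Hal : forall e z, Rabs z < 1 / 2 ->
  is_series (fun n => al e n * z ^ n) (oip (f (oreal z)) e)).
{ intros e. exact (epsilon_spec (inhabits (fun _ : nat => 0)) _ (X e)). }
assert (U : forall e r (b : nat -> R), 0 < r <= 1 / 2 ->
  (forall z, Rabs z < r -> is_series (fun n => b n * z ^ n) (oip (f (oreal z)) e)) ->
  forall n, b n = al e n).
{ intros e r b Hr Hb n.
  apply (pseries_coeff_unique b (al e) (fun z => oip (f (oreal z)) e) r n (proj1 Hr) Hb).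
  intros z Hz. apply Hal; lra. }
(* By uniqueness the coefficients are linear in e, hence represented by octonions. *)
assert (RP : forall n, exists v, forall e, al e n = oip v e).
{ intros n. apply (oip_representation (fun e => al e n)).
  - intros p q. symmetry. apply (U _ (1 / 2) (fun n => al p n + al q n)); [lra|].
    intros z Hz. rewrite oip_sym, oip_plus_l, !(oip_sym _ (f _)).
    refine (is_series_ext _ _ _ _ (is_series_plus _ _ _ _ (Hal p z Hz) (Hal q z Hz))).
    intros k. change (plus ?u ?v) with (u + v).
    real_eq. ring.
  - intros c p. symmetry. apply (U _ (1 / 2) (fun n => c * al p n)); [lra|].
    intros z Hz. rewrite oip_sym, oip_scal_l, (oip_sym _ (f _)).
    refine (is_series_ext _ _ _ _ (is_series_scal_l c _ _ (Hal p z Hz))).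
    intros k. change (scal ?u ?v) with (u * v).
    real_eq. ring. }
exists (fun n => epsilon (inhabits ozero) (fun v => forall e, al e n = oip v e)).
set (a n := epsilon (inhabits ozero) (fun v => forall e, al e n = oip v e)).
assert (Ha : forall n e, al e n = oip (a n) e).
{ intros n. exact (epsilon_spec (inhabits ozero) _ (RP n)). }
intros w Hw. change (is_series (fun n => omul (opow w n) (a n)) (f w)).
unfold oball in Hw. destruct (oct_polar w) as (I & x & HI & E).
set (s := norm w) in *. assert (Hs : 0 <= s) by apply norm_ge_0.
set (r := (1 + s) / 2). assert (Hr : 0 < r < 1) by (unfold r; lra).
apply is_series_oct. intros e.
destruct (slice_taylor I e HI) as (A & A' & H).
(* The coefficients on the slice of w are compared with those of the real axis on an interval where
   both series converge. *)
assert (EA : forall n, A r n = oip (a n) e).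
{ intros n. rewrite <- Ha. apply (U e (Rmin r (1 / 2))).
  - split; [apply Rmin_glb_lt; lra|apply Rmin_r].
  - intros z Hz. apply (is_series_on_reals (A r) (A' r) I e r).
    + intros t y Ht. exact (proj1 (H r t y ltac:(lra) ltac:(lra))).
    + apply Rlt_le_trans with (1 := Hz), Rmin_l. }
(* [A'] belongs to <f, I e>, and <a_n, I e> = - <I a_n, e>. *)
assert (EA' : forall n, A' r n = - oip (omul I (a n)) e).
{ intros n. rewrite oip_imag_skew, Ropp_involutive, <- Ha by easy. apply (U _ (Rmin r (1 / 2))).
  - split; [apply Rmin_glb_lt; lra|apply Rmin_r].
  - intros z Hz. apply (is_series_on_reals (A' r) (fun n => - A r n) I _ r).
    + intros t y Ht. destruct (H r t y ltac:(lra) Ht) as [_ H']. revert H'.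
      apply is_series_ext. intros k. real_eq. ring.
    + apply Rlt_le_trans with (1 := Hz), Rmin_l. }
destruct (H r s x Hr ltac:(unfold r; lra)) as [H' _].
rewrite <- E in H'. revert H'. apply is_series_ext. intros n.
rewrite E, oip_opow_polar, EA, EA' by easy.
real_eq. ring.
Qed.

Lemma coeff_spec : power_expansion f (coeff f).
Proof. exact (epsilon_spec (inhabits (fun _ : nat => ozero)) _ slice_regular_power_expansion). Qed.

End SliceRegularExpansion.

Lemma power_expansion_real (f : oct -> oct) (a : nat -> oct) (e : oct) (z : R) :
  power_expansion f a -> Rabs z < 1 ->
  is_series (fun n => oip (a n) e * z ^ n) (oip (f (oreal z)) e).
Proof.
intros H Hz.
assert (S := H (oreal z) ltac:(unfold oball; now rewrite norm_oreal)).
apply (is_series_oip _ _ e) in S. revert S. apply is_series_ext. intros n.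
rewrite opow_real, omul_real_l, oip_scal_l. apply Rmult_comm.
Qed.

Lemma power_expansion_unique (f : oct -> oct) (a b : nat -> oct) (n : nat) :
  power_expansion f a -> power_expansion f b -> a n = b n.
Proof.
intros Ha Hb. apply oip_ext. intros e.
apply (pseries_coeff_unique (fun n => oip (a n) e) (fun n => oip (b n) e)
  (fun z => oip (f (oreal z)) e) 1); [lra| |]; intros z Hz; now apply power_expansion_real.
Qed.

Lemma power_expansion_bound (f : oct -> oct) (a : nat -> oct) (r : R) :
  power_expansion f a -> 0 <= r < 1 ->
  exists C, 0 <= C /\ forall n, r ^ n * norm (a n) <= C.
Proof.
intros H Hr.
destruct (is_series_norm_bounded _ _ (H (oreal r) ltac:(unfold oball; rewrite norm_oreal, Rabs_pos_eq; lra)))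
  as (C & HC & B).
exists C. split; [easy|]. intros n. specialize (B n).
now rewrite norm_omul, norm_opow, norm_oreal, Rabs_pos_eq in B by lra.
Qed.

Lemma power_expansion_0 (f : oct -> oct) (a : nat -> oct) : power_expansion f a -> f ozero = a 0%nat.
Proof.
intros H. apply oip_ext. intros e.
assert (S := power_expansion_real f a e 0 H ltac:(rewrite Rabs_R0; lra)).
apply is_series_unique in S. change (oreal 0) with ozero in S. rewrite <- S.
apply is_series_unique.
refine (is_series_ext _ _ _ _ (is_series_single (oip (a 0%nat) e) 0)).
intros [|n]; simpl; real_eq; ring.
Qed.

Lemma Derive_power_series_0 (b : nat -> R) (F : R -> R) (l : R) :
  (forall z, Rabs z < 1 -> is_series (fun n => b n * z ^ n) (F z)) ->
  is_derive F 0 l -> l = b 1%nat.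
Proof.
intros Hb Hl.
assert (CV : Rbar_lt 0 (CV_radius b)).
{ apply Rbar_lt_le_trans with (Rabs (1 / 2)); [simpl; apply Rabs_pos_lt; lra|].
  apply Rbar_not_lt_le. intros D. apply CV_disk_outside in D. apply D.
  apply ex_series_lim_0. exists (F (1 / 2)). apply Hb. rewrite Rabs_pos_eq; lra. }
assert (D : is_derive F 0 (PSeries (PS_derive b) 0)).
{ apply (is_derive_ext_loc (PSeries b)).
  - exists (mkposreal 1 Rlt_0_1). intros z Hz.
    assert (Z : Rabs z < 1).
    { unfold ball in Hz; simpl in Hz; unfold AbsRing_ball, abs, minus, plus, opp in Hz; simpl in Hz.
      now rewrite Ropp_0, Rplus_0_r in Hz. }
    apply is_pseries_unique, is_pseries_R, Hb, Z.
  - apply is_derive_PSeries. now rewrite Rabs_R0. }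
rewrite <- (is_derive_unique _ _ _ Hl), (is_derive_unique _ _ _ D), PSeries_0.
unfold PS_derive. simpl. ring.
Qed.

Lemma slice_derive_0 (f : oct -> oct) : slice_regular oball f ->
  slice_derive f ozero = coeff f 1%nat.
Proof.
intros Hf. assert (Ha := coeff_spec f Hf). set (a := coeff f) in *.
assert (Hi : imag_unit ounit_i) by (unfold imag_unit; oct_ring).
assert (E : slice_unit ozero = ounit_i).
{ unfold slice_unit. destruct (excluded_middle_informative _) as [_|N]; [easy|].
  exfalso; apply N. oct_ring. }
assert (E2 : norm (oim ozero) = 0).
{ replace (oim ozero) with ozero by oct_ring. rewrite norm_oip, oip_zero_l; apply sqrt_0. }
unfold slice_derive. rewrite E, E2. change (ore ozero) with 0.
assert (D : 0 ^ 2 + 0 ^ 2 < 1) by lra.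
assert (Dx : slice_dx f ounit_i 0 0 = a 1%nat).
{ apply oip_ext. intros e.
  apply (Derive_power_series_0 (fun n => oip (a n) e) (fun t => oip (f (slice_pt ounit_i t 0)) e)).
  - intros z Hz. replace (slice_pt ounit_i z 0) with (oreal z) by oct_ring.
    now apply power_expansion_real.
  - apply (is_derive_oip (fun t => f (slice_pt ounit_i t 0))), (is_derive_slice_dx f Hf); easy. }
(* The derivative in y follows from the one in x by the Cauchy-Riemann equation. *)
assert (Dy : slice_dy f ounit_i 0 0 = omul ounit_i (a 1%nat)).
{ apply oip_ext. intros e. rewrite (slice_cauchy_riemann f Hf) by easy.
  rewrite Dx, oip_imag_skew by easy. easy. }
rewrite Dx, Dy, omul_imag_twice by easy. generalize (a 1%nat).
intros p. transitivity (scal (1 / 2 * 2) p); [oct_ring|].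
replace (1 / 2 * 2) with 1 by field. oct_ring.
Qed.

(** * Regular diameter *)

(** Here |l|^2 is the sum of the <b_n, l>, at most |l| times a geometric sum; then |l| is divided
    out. *)
Lemma norm_series_le (b : nat -> oct) (l : oct) (c q : R) : 0 <= c -> 0 <= q < 1 ->
  (forall n, norm (b n) <= c * q ^ n) -> is_series b l -> norm l <= c / (1 - q).
Proof.
intros Hc Hq Hb H.
assert (P := norm_ge_0 l).
assert (B : forall n, Rabs (oip (b n) l) <= norm l * c * q ^ n).
{ intros n. eapply Rle_trans; [apply oip_le_norm|]. specialize (Hb n). nra. }
assert (T := series_tail_geom _ _ (norm l * c) q 0 ltac:(nra) Hq B (is_series_oip _ _ l H)).
rewrite sum_O in T. specialize (B 0%nat). simpl in B.
rewrite <- norm_oip_sqr in T.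
assert (E : norm l * norm l <= norm l * (c / (1 - q))).
{ replace (norm l * (c / (1 - q))) with (norm l * c * q ^ 1 / (1 - q) + norm l * c * 1)
    by (simpl; field; lra).
  apply Rabs_le_between in T. apply Rabs_le_between in B. lra. }
destruct P as [P|P].
- now apply Rmult_le_reg_l in E.
- rewrite <- P. apply Rdiv_le_0_compat; lra.
Qed.

Lemma oip_omul_adj (p v e : oct) :
  oip (omul p v) e = oip v (omul (minus (oreal (2 * ore p)) p) e).
Proof. oct_ring. Qed.

Lemma is_series_omul (p : oct) (b : nat -> oct) (l : oct) :
  is_series b l -> is_series (fun n => omul p (b n)) (omul p l).
Proof.
intros H. apply is_series_oct. intros e. rewrite oip_omul_adj.
apply (is_series_oip _ _ (omul (minus (oreal (2 * ore p)) p) e)) in H. revert H.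
apply is_series_ext. intros n. symmetry. apply oip_omul_adj.
Qed.

Lemma ge_0_of_approach (F : R -> R) (c : R) : continuous F c ->
  (forall d, 0 < d -> exists y, Rabs (y - c) < d /\ 0 <= F y) -> 0 <= F c.
Proof.
intros C H. apply Rnot_lt_le. intros N.
destruct (proj1 (filterlim_locally _ _) C (mkposreal _ (Ropp_0_gt_lt_contravar _ N))) as [d Hd].
destruct (H d (cond_pos d)) as (y & Hy & P).
specialize (Hd y Hy). unfold ball in Hd; simpl in Hd; unfold AbsRing_ball, abs, minus, plus, opp in Hd; simpl in Hd.
apply Rabs_lt_between in Hd. lra.
Qed.

(** Carries estimates from circles of radius less than 1 to the unit circle. *)
Lemma ge_0_at_1 (F : R -> R) (r : R) : r < 1 -> continuous F 1 ->
  (forall s, r < s < 1 -> 0 <= F s) -> 0 <= F 1.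
Proof.
intros Hr C H. apply ge_0_of_approach; [easy|]. intros d Hd0.
set (m := Rmax r (1 - d)).
assert (M1 : r <= m) by apply Rmax_l.
assert (M2 : 1 - d <= m) by apply Rmax_r.
assert (M3 : m < 1) by (apply Rmax_lub_lt; lra).
exists ((m + 1) / 2). split; [apply Rabs_lt_between; lra|apply H; lra].
Qed.

Section RegularDiameter.

Variable f : oct -> oct.
Variable a : nat -> oct.
Hypothesis Ha : power_expansion f a.
Hypothesis Ea : coeff f = a.

(** At the larger radius r = (1 + s) / 2 the terms are bounded, which gives the ratio q = s / r. *)
Lemma power_expansion_geom (s : R) : 0 <= s < 1 ->
  exists C q, 0 <= C /\ 0 <= q < 1 /\ forall n, s ^ n * norm (a n) <= C * q ^ n.
Proof.
intros Hs. set (r := (1 + s) / 2).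
destruct (power_expansion_bound f a r Ha ltac:(unfold r; lra)) as (C & HC & B).
exists C, (s / r). split; [easy|]. split.
- unfold r. split; [apply Rdiv_le_0_compat; lra|apply Rlt_div_l; lra].
- intros n. assert (Pr : 0 < r ^ n) by (apply pow_lt; unfold r; lra).
  assert (Ps : 0 <= s ^ n) by (apply pow_le; lra).
  unfold Rdiv. rewrite Rpow_mult_distr, pow_inv.
  replace (s ^ n * norm (a n)) with (s ^ n * / r ^ n * (r ^ n * norm (a n))) by (field; lra).
  rewrite (Rmult_comm C). apply Rmult_le_compat_l; [|apply B].
  apply Rmult_le_pos; [easy|left; now apply Rinv_0_lt_compat].
Qed.

Lemma f_sub_term_le (s : R) (u w : oct) (n : nat) : norm u <= 1 -> norm w <= s ->
  norm (omul (opow w n) (omul (opow u n) (a n))) <= s ^ n * norm (a n).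
Proof.
intros Hu Hw. rewrite !norm_omul, !norm_opow.
pose proof (norm_ge_0 u). pose proof (norm_ge_0 w). pose proof (norm_ge_0 (a n)).
assert (norm u ^ n <= 1) by (rewrite <- (pow1 n); apply pow_incr; lra).
assert (norm w ^ n <= s ^ n) by (apply pow_incr; lra).
assert (0 <= norm u ^ n) by (apply pow_le; lra).
assert (0 <= norm w ^ n) by (apply pow_le; lra).
apply Rmult_le_compat; try easy; [apply Rmult_le_pos; easy|nra].
Qed.

Lemma f_sub_spec (u w : oct) : norm u <= 1 -> norm w < 1 ->
  is_series (fun n => omul (opow w n) (omul (opow u n) (a n))) (f_sub f u w).
Proof.
intros Hu Hw. unfold f_sub. rewrite Ea.
destruct (power_expansion_geom (norm w) ltac:(split; [apply norm_ge_0|easy])) as (C & q & HC & Hq & B).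
assert (X := ex_is_series_oct_geom (fun n => omul (opow w n) (omul (opow u n) (a n))) C q Hq
  (fun n => Rle_trans _ _ _ (f_sub_term_le (norm w) u w n Hu (Rle_refl _)) (B n))).
exact (epsilon_spec (inhabits ozero) _ X).
Qed.

Definition f_diff (u v w : oct) : oct := minus (f_sub f u w) (f_sub f v w).

Definition diff_coeff (u v : oct) (n : nat) : oct :=
  minus (omul (opow u n) (a n)) (omul (opow v n) (a n)).

Lemma f_diff_spec (u v w : oct) : norm u <= 1 -> norm v <= 1 -> norm w < 1 ->
  is_series (fun n => omul (opow w n) (diff_coeff u v n)) (f_diff u v w).
Proof.
intros Hu Hv Hw. apply is_series_oct. intros e.
assert (S := is_series_minus _ _ _ _ (is_series_oip _ _ e (f_sub_spec u w Hu Hw))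
  (is_series_oip _ _ e (f_sub_spec v w Hv Hw))).
unfold f_diff. rewrite oip_minus_l. revert S. apply is_series_ext. intros n.
unfold diff_coeff. rewrite omul_minus_r, oip_minus_l. easy.
Qed.

Lemma diff_coeff_0 (u v : oct) : diff_coeff u v 0 = ozero.
Proof. unfold diff_coeff. simpl. generalize (a 0%nat). oct_ring. Qed.

Lemma norm_diff_coeff (u v : oct) (n : nat) : norm u <= 1 -> norm v <= 1 ->
  norm (diff_coeff u v n) <= 2 * norm (a n).
Proof.
intros Hu Hv. unfold diff_coeff. eapply Rle_trans; [apply onorm_minus|].
rewrite !norm_omul, !norm_opow.
pose proof (norm_ge_0 u). pose proof (norm_ge_0 v). pose proof (norm_ge_0 (a n)).
assert (norm u ^ n <= 1) by (rewrite <- (pow1 n); apply pow_incr; lra).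
assert (norm v ^ n <= 1) by (rewrite <- (pow1 n); apply pow_incr; lra). nra.
Qed.

(** Since [real] sends infinite values to 0, the supremum has to be shown finite: a geometric
    majorant bounds it above, and the set is not empty. *)
Lemma regular_diam_is_lub (r : R) : 0 < r < 1 ->
  is_lub_Rbar (fun d => exists u v w, norm u <= 1 /\ norm v <= 1 /\ norm w <= r /\
    d = norm (f_diff u v w)) (regular_diam f r).
Proof.
intros Hr. unfold regular_diam.
match goal with |- is_lub_Rbar ?E _ => set (D := E) end.
change (Lub_Rbar _) with (Lub_Rbar D).
assert (L := Lub_Rbar_correct D).
destruct (power_expansion_geom r ltac:(lra)) as (C & q & HC & Hq & B).
assert (UB : is_ub_Rbar D (2 * (C / (1 - q)))).
{ intros d (u & v & w & Hu & Hv & Hw & ->). simpl.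
  assert (N : forall u, norm u <= 1 -> norm (f_sub f u w) <= C / (1 - q)).
  { intros u' Hu'. apply (norm_series_le _ _ C q HC Hq) with (2 := f_sub_spec u' w Hu' ltac:(lra)).
    intros n. eapply Rle_trans; [apply (f_sub_term_le r)|]; easy. }
  eapply Rle_trans; [apply onorm_minus|].
  pose proof (N u Hu). pose proof (N v Hv). lra. }
assert (NE : D (norm (f_diff ozero ozero ozero))).
{ exists ozero, ozero, ozero.
  assert (Z : norm ozero = 0) by (rewrite norm_oip, oip_zero_l; apply sqrt_0).
  rewrite !Z. repeat split; lra. }
destruct (Lub_Rbar D) as [x| |]; simpl.
- exact L.
- destruct L as [_ L]. now specialize (L _ UB).
- destruct L as [L _]. now specialize (L _ NE).
Qed.

Lemma le_regular_diam (r : R) (u v w : oct) : 0 < r < 1 -> norm u <= 1 -> norm v <= 1 ->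
  norm w <= r -> norm (f_diff u v w) <= regular_diam f r.
Proof.
intros Hr Hu Hv Hw. destruct (regular_diam_is_lub r Hr) as [L _].
apply (L (norm (f_diff u v w))). now exists u, v, w.
Qed.

Lemma regular_diam_le (r K : R) : 0 < r < 1 ->
  (forall u v w, norm u <= 1 -> norm v <= 1 -> norm w <= r -> norm (f_diff u v w) <= K) ->
  regular_diam f r <= K.
Proof.
intros Hr H. destruct (regular_diam_is_lub r Hr) as [_ L].
apply (L K). intros d (u & v & w & Hu & Hv & Hw & ->). now apply H.
Qed.

Lemma regular_diam_near (d : R) : is_regular_diam_ball f d ->
  forall eps s, 0 < eps -> s < 1 ->
  exists r, s < r /\ 0 < r < 1 /\ Rabs (regular_diam f r - d) < eps.
Proof.
intros H eps s Heps Hs.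
destruct (proj1 (filterlim_locally _ _) H (mkposreal eps Heps)) as [del Hdel].
set (m := Rmax (Rmax s 0) (1 - del)).
assert (M1 : s <= m) by (eapply Rle_trans; [apply Rmax_l|apply Rmax_l]).
assert (M2 : 0 <= m) by (eapply Rle_trans; [apply Rmax_r|apply Rmax_l]).
assert (M3 : 1 - del <= m) by apply Rmax_r.
assert (M4 : m < 1).
{ pose proof (cond_pos del). repeat apply Rmax_lub_lt; lra. }
exists ((m + 1) / 2). repeat split; try lra.
apply Hdel; [|lra].
unfold ball; simpl; unfold AbsRing_ball, abs, minus, plus, opp; simpl.
apply Rabs_lt_between. lra.
Qed.

Hypothesis Hd : is_regular_diam_ball f 2.

(** A value above 2 at w would be a lower bound for the diameters at all r > |w|, hence for their
    limit. *)
Lemma norm_f_diff_le_2 (u v w : oct) : norm u <= 1 -> norm v <= 1 -> norm w < 1 ->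
  norm (f_diff u v w) <= 2.
Proof.
intros Hu Hv Hw. apply Rnot_lt_le. intros N.
destruct (regular_diam_near 2 Hd (norm (f_diff u v w) - 2) (norm w) ltac:(lra) Hw) as (r & R1 & R2 & R3).
pose proof (le_regular_diam r u v w R2 Hu Hv ltac:(lra)).
apply Rabs_lt_between in R3. lra.
Qed.

(* [f_quot I u v s x e] is the [e]-component of [w^-1 (f_u w - f_v w)] for
   [w = s exp (I x)]. *)
Definition f_quot (I u v : oct) (s x : R) (e : oct) : R :=
  / s * oip (omul (slice_pt I (cos x) (- sin x))
    (f_diff u v (slice_pt I (s * cos x) (s * sin x)))) e.

(** * Harmonic estimates on one slice, along one direction *)

Section Slice.

Variables (I u v e : oct).
Hypothesis HI : imag_unit I.
Hypothesis Hu : norm u <= 1.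
Hypothesis Hv : norm v <= 1.
Hypothesis He : norm e = 1.

Let b := diff_coeff u v.
(** The index is shifted because division by w lowers every exponent by one. *)
Let A n := oip (b (S n)) e.
Let B n := oip (omul I (b (S n))) e.

Lemma is_series_f_quot (s x : R) : 0 < s < 1 ->
  is_series (fun n => s ^ n * trig A B x n) (f_quot I u v s x e).
Proof.
intros Hs. set (w := slice_pt I (s * cos x) (s * sin x)).
assert (Nw : norm w = s) by (apply norm_slice_pt_polar; lra || easy).
assert (S := f_diff_spec u v w Hu Hv ltac:(lra)).
apply (is_series_omul (slice_pt I (cos x) (- sin x))) in S.
apply (is_series_oip _ _ e) in S.
assert (S' := is_series_scal_l (/ s) _ _ S). clear S.
set (y n := / s * oip (omul (slice_pt I (cos x) (- sin x)) (omul (opow w n) (b n))) e).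
change (is_series y (f_quot I u v s x e)) in S'.
(* As b_0 = 0, the series can start at index 1 with the same sum. *)
assert (Y0 : y 0%nat = 0).
{ unfold y, b. rewrite diff_coeff_0.
  rewrite !omul_zero_r, oip_zero_l. ring. }
assert (S : is_series (fun n => y (S n)) (f_quot I u v s x e)).
{ apply (is_series_incr_1 y). rewrite Y0.
  match goal with |- is_series _ ?l => replace l with (f_quot I u v s x e) by (symmetry; apply Rplus_0_r) end.
  exact S'. }
revert S. apply is_series_ext. intros n. unfold y, w.
rewrite opow_polar by easy.
rewrite omul_slice_twice by easy.
replace (cos x * (s ^ S n * cos (INR (S n) * x)) - - sin x * (s ^ S n * sin (INR (S n) * x)))
  with (s ^ S n * cos (INR (S n) * x - x)) by (rewrite cos_minus; ring).
replace (cos x * (s ^ S n * sin (INR (S n) * x)) + - sin x * (s ^ S n * cos (INR (S n) * x)))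
  with (s ^ S n * sin (INR (S n) * x - x)) by (rewrite sin_minus; ring).
replace (INR (S n) * x - x) with (INR n * x) by (rewrite S_INR; ring).
rewrite omul_slice, oip_plus_l, !oip_scal_l. unfold trig, A, B.
real_eq.
simpl pow. rewrite !Rmult_plus_distr_l, <- !Rmult_assoc, Rinv_l by lra. ring.
Qed.

Lemma f_quot_le (s x : R) : 0 < s < 1 -> s * f_quot I u v s x e <= 2.
Proof.
intros Hs. unfold f_quot. rewrite <- Rmult_assoc, Rinv_r, Rmult_1_l by lra.
eapply Rle_trans; [apply Rle_abs|]. eapply Rle_trans; [apply oip_le_norm|].
rewrite norm_omul, norm_slice_conj, He, Rmult_1_l, Rmult_1_r by easy.
apply norm_f_diff_le_2; try easy. rewrite norm_slice_pt_polar by (easy || lra). lra.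
Qed.

(* The coefficients of the nonnegative harmonic function [2 / s - f_quot] on the
   circle of radius [s]. *)
Let al (s : R) (n : nat) : R := (if Nat.eq_dec n 0 then 2 / s else 0) - s ^ n * A n.
Let be (s : R) (n : nat) : R := - (s ^ n * B n).

Lemma trig_al_be (s x : R) (n : nat) :
  trig (al s) (be s) x n = (if Nat.eq_dec n 0 then 2 / s else 0) - s ^ n * trig A B x n.
Proof.
unfold trig, al, be. destruct (Nat.eq_dec n 0) as [->|_]; [|ring].
change (INR 0) with 0. rewrite Rmult_0_l, cos_0, sin_0. ring.
Qed.

Lemma coeff_geom (s : R) : 0 < s < 1 -> exists c q, 0 <= c /\ 0 <= q < 1 /\
  (forall n, Rabs (al s n) <= c * q ^ n) /\ (forall n, Rabs (be s n) <= c * q ^ n).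
Proof.
intros Hs. destruct (power_expansion_geom s ltac:(lra)) as (C & q & HC & Hq & G).
(* The factor 2 comes from [norm_diff_coeff], and q / s from the index shift. *)
set (K := 2 * / s * C * q).
assert (PK : 0 <= K).
{ unfold K. apply Rmult_le_pos; [|lra]. apply Rmult_le_pos; [|easy].
  assert (0 < / s) by (apply Rinv_0_lt_compat; lra). lra. }
assert (X : forall n p, norm p = 1 -> forall c, Rabs (oip (omul c (b (S n))) p) <= norm c * norm (b (S n))).
{ intros n p Hp c. eapply Rle_trans; [apply oip_le_norm|]. rewrite norm_omul, Hp. lra. }
assert (NI : norm I = 1).
{ rewrite norm_oip. destruct (imag_unit_spec I HI) as [_ ->]. apply sqrt_1. }
assert (Y : forall n, s ^ n * norm (b (S n)) <= K * q ^ n).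
{ intros n. specialize (G (S n)). assert (Z := norm_diff_coeff u v (S n) Hu Hv). fold b in Z.
  assert (Ps : 0 <= s ^ n) by (apply pow_le; lra).
  apply Rle_trans with (2 * / s * (s ^ S n * norm (a (S n)))).
  - simpl pow. replace (2 * / s * (s * s ^ n * norm (a (S n)))) with (s ^ n * (2 * norm (a (S n)))) by (field; lra).
    now apply Rmult_le_compat_l.
  - replace (K * q ^ n) with (2 * / s * (C * q ^ S n)) by (unfold K; simpl; ring).
    apply Rmult_le_compat_l; [|easy].
    assert (0 < / s) by (apply Rinv_0_lt_compat; lra). lra. }
assert (D : 0 < 2 / s) by (apply Rdiv_lt_0_compat; lra).
exists (2 / s + K), q. split; [lra|]. split; [easy|].
assert (Q : forall n, 0 <= q ^ n) by (intros; apply pow_le; lra).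
assert (Z : forall n z, Rabs z <= norm (b (S n)) -> Rabs (s ^ n * z) <= K * q ^ n).
{ intros n z Hz. rewrite Rabs_mult, (Rabs_pos_eq (s ^ n)) by (apply pow_le; lra).
  eapply Rle_trans; [|apply Y]. apply Rmult_le_compat_l; [apply pow_le; lra|easy]. }
split; intros n.
- assert (ZA : Rabs (s ^ n * A n) <= K * q ^ n).
  { apply Z. unfold A. eapply Rle_trans; [apply oip_le_norm|]. rewrite He. lra. }
  unfold al. destruct (Nat.eq_dec n 0) as [->|N].
  + eapply Rle_trans; [apply Rabs_triang|]. rewrite Rabs_Ropp, Rabs_pos_eq by lra. simpl in *. lra.
  + rewrite Rminus_0_l, Rabs_Ropp. specialize (Q n). nra.
- assert (ZB : Rabs (s ^ n * B n) <= K * q ^ n).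
  { apply Z. unfold B. eapply Rle_trans; [apply X; easy|]. rewrite NI. lra. }
  unfold be. rewrite Rabs_Ropp. specialize (Q n). nra.
Qed.

Lemma is_series_al_be (s x : R) : 0 < s < 1 ->
  is_series (trig (al s) (be s) x) (2 / s - f_quot I u v s x e).
Proof.
intros Hs.
refine (is_series_ext _ _ _ _ (is_series_minus _ _ _ _ (is_series_single (2 / s) 0) (is_series_f_quot s x Hs))).
intros n. rewrite trig_al_be. easy.
Qed.

Lemma al_be_ge_0 (s x : R) : 0 < s < 1 -> 0 <= 2 / s - f_quot I u v s x e.
Proof.
intros Hs. pose proof (f_quot_le s x Hs).
enough (f_quot I u v s x e <= 2 / s) by lra.
apply Rmult_le_reg_l with s; [lra|]. replace (s * (2 / s)) with 2 by (field; lra). easy.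
Qed.

(** The coefficient estimate on the circle of radius s, where the constant term is 2 / s - A_0; then
    s tends to 1. *)
Lemma diff_coeff_trig_le (n : nat) (x : R) : (1 <= n)%nat ->
  trig A B x n <= 2 * (2 - A 0%nat).
Proof.
intros Hn.
enough (0 <= 2 * (2 / 1 - A 0%nat) - 1 ^ n * trig A B x n).
{ rewrite pow1 in H. lra. }
apply (ge_0_at_1 (fun s => 2 * (2 / s - A 0%nat) - s ^ n * trig A B x n) 0); [lra| |].
- apply (ex_derive_continuous (V := R_NormedModule)). auto_derive. lra.
- intros s Hs. destruct (coeff_geom s Hs) as (c & q & Hc & Hq & Hal & Hbe).
  assert (L := trig_series_coeff_le (al s) (be s) _ c q Hc Hq Hal Hbe
    (fun t => is_series_al_be s t Hs) (fun t => al_be_ge_0 s t Hs) n x Hn).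
  rewrite trig_al_be in L. destruct (Nat.eq_dec n 0); [lia|].
  unfold al in L. destruct (Nat.eq_dec 0 0); [|easy]. simpl pow in L. lra.
Qed.

(** For n = 1, the angles 0 and pi bound A_1 and -A_1 by the same multiple of 2 - A_0; the two
    bounds are added. *)
Lemma diff_coeff_1_le : A 0%nat <= 2.
Proof.
assert (L1 := diff_coeff_trig_le 1 0 ltac:(lia)).
assert (L2 := diff_coeff_trig_le 1 PI ltac:(lia)).
unfold trig in *. simpl INR in *. rewrite !Rmult_1_l in *.
rewrite cos_0, sin_0 in L1. rewrite cos_PI, sin_PI in L2. lra.
Qed.

Lemma diff_coeff_abs_le (n : nat) : (1 <= n)%nat ->
  Rabs (A n) <= 2 * (2 - A 0%nat) /\ Rabs (B n) <= 2 * (2 - A 0%nat).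
Proof.
intros Hn. assert (N : INR n <> 0) by (apply not_0_INR; lia).
assert (X : forall y, A n * cos y + B n * sin y <= 2 * (2 - A 0%nat)).
{ intros y. assert (L := diff_coeff_trig_le n (y / INR n) Hn). unfold trig in L.
  replace (INR n * (y / INR n)) with y in L by (field; easy). exact L. }
assert (X1 := X 0). assert (X2 := X PI). assert (X3 := X (PI / 2)). assert (X4 := X (- (PI / 2))).
rewrite cos_0, sin_0 in X1. rewrite cos_PI, sin_PI in X2. rewrite cos_PI2, sin_PI2 in X3.
rewrite cos_neg, sin_neg, cos_PI2, sin_PI2 in X4.
split; apply Rabs_le; lra.
Qed.

(** Harnack's inequality in the disk of radius r for 2 / r minus the quotient, at relative radius s
    / r; then r tends to 1. *)
Lemma f_quot_harnack (s x : R) : 0 < s < 1 ->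
  f_quot I u v s x e <= 2 - (2 - A 0%nat) * ((1 - s) / (1 + s)).
Proof.
intros Hs.
enough (0 <= 2 / 1 - f_quot I u v s x e - (2 / 1 - A 0%nat) * ((1 - s / 1) / (1 + s / 1))).
{ rewrite !Rdiv_1_r in H. lra. }
apply (ge_0_at_1 (fun r => 2 / r - f_quot I u v s x e - (2 / r - A 0%nat) * ((1 - s / r) / (1 + s / r))) s); [lra| |].
- apply (ex_derive_continuous (V := R_NormedModule)). auto_derive.
  repeat split; lra.
- intros r Hr. destruct (coeff_geom r ltac:(lra)) as (c & q & Hc & Hq & Hal & Hbe).
  assert (Hsr : 0 <= s / r < 1) by (split; [apply Rdiv_le_0_compat; lra|apply Rlt_div_l; lra]).
  assert (S : is_series (fun n => (s / r) ^ n * trig (al r) (be r) x n) (2 / r - f_quot I u v s x e)).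
  { refine (is_series_ext _ _ _ _ (is_series_minus _ _ _ _ (is_series_single (2 / r) 0) (is_series_f_quot s x Hs))).
    intros n. rewrite trig_al_be.
    transitivity ((if Nat.eq_dec n 0 then 2 / r else 0) - s ^ n * trig A B x n); [easy|].
    destruct (Nat.eq_dec n 0) as [->|_].
    - now rewrite !pow_O, !Rmult_1_l.
    - rewrite !Rminus_0_l, <- Ropp_mult_distr_r, <- Rmult_assoc, <- Rpow_mult_distr.
      now replace (s / r * r) with s by (field; lra). }
  assert (L := trig_series_harnack (al r) (be r) _ c q Hc Hq Hal Hbe
    (fun t => is_series_al_be r t ltac:(lra)) (fun t => al_be_ge_0 r t ltac:(lra)) (s / r) x _ Hsr S).
  unfold al in L. destruct (Nat.eq_dec 0 0); [|easy]. simpl pow in L. lra.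
Qed.

End Slice.
End RegularDiameter.

Lemma norm_normalize (p : oct) : norm p <> 0 -> norm (scal (/ norm p) p) = 1.
Proof.
intros H. pose proof (norm_ge_0 p).
rewrite onorm_scal, Rabs_pos_eq; [now apply Rinv_l|]. left. apply Rinv_0_lt_compat. lra.
Qed.

Lemma oip_normalize (p : oct) : norm p <> 0 -> oip p (scal (/ norm p) p) = norm p.
Proof. intros H. rewrite oip_sym, oip_scal_l, <- norm_oip_sqr. now field. Qed.

Lemma imag_unit_i : imag_unit ounit_i.
Proof. unfold imag_unit. oct_ring. Qed.

(** Near al = 0 the left side is of first order unless y = 0, while the right side is of second
    order. *)
Lemma tangent_bound_eq_0 (y : R) (n : nat) : (1 <= n)%nat ->
  (forall al, Rabs (2 * sin (INR n * al) * y) <= 4 * (1 - cos al)) -> y = 0.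
Proof.
intros Hn H.
assert (P := PI_RGT_0).
assert (Nn : 1 <= INR n) by (apply (le_INR 1 n); easy).
assert (B : forall d, 0 < d -> exists be, Rabs (be - 0) < d /\ 0 <= 2 * sin be - Rabs y * cos be).
{ intros d Hd0. set (be := Rmin (d / 2) (PI / (4 * INR n))).
  assert (B0 : 0 < be) by (apply Rmin_glb_lt; [lra|apply Rdiv_lt_0_compat; lra]).
  assert (B1 : be <= d / 2) by apply Rmin_l.
  assert (B2 : be <= PI / (4 * INR n)) by apply Rmin_r.
  exists be. split; [rewrite Rminus_0_r, Rabs_pos_eq; lra|].
  assert (B3 : INR n * (2 * be) <= PI / 2).
  { apply Rle_trans with (INR n * (2 * (PI / (4 * INR n)))); [nra|right; field; lra]. }
  assert (B4 : 2 * be <= INR n * (2 * be)) by nra.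
  assert (S1 : sin (2 * be) <= sin (INR n * (2 * be))) by (apply sin_incr_1; lra).
  assert (S2 : 0 < sin be) by (apply sin_gt_0; lra).
  assert (S3 : 0 < cos be) by (apply cos_gt_0; lra).
  specialize (H (2 * be)).
  rewrite !Rabs_mult, (Rabs_pos_eq 2), (Rabs_pos_eq (sin _)) in H.
  2: { rewrite sin_2a in S1. nra. }
  2: lra.
  rewrite cos_2a_sin in H. rewrite sin_2a in S1.
  pose proof (Rabs_pos y).
  assert (T : sin be * (Rabs y * cos be) <= sin be * (2 * sin be)) by nra.
  apply Rmult_le_reg_l in T; lra. }
assert (F := ge_0_of_approach (fun be => 2 * sin be - Rabs y * cos be) 0
  ltac:(apply (ex_derive_continuous (V := R_NormedModule)); auto_derive; easy) B).
cbn beta in F. rewrite sin_0, cos_0 in F. pose proof (Rabs_pos y).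
destruct (Req_dec y 0) as [E|E]; [easy|]. apply Rabs_pos_lt in E. lra.
Qed.

(** * Bounds for functions of regular diameter 2 *)

Section DiameterTwo.

Variable f : oct -> oct.
Variable a : nat -> oct.
Hypothesis Ha : power_expansion f a.
Hypothesis Ea : coeff f = a.
Hypothesis Hd : is_regular_diam_ball f 2.

Lemma norm_coeff_1_le : norm (a 1%nat) <= 1.
Proof.
destruct (Req_dec (norm (a 1%nat)) 0) as [Z|Z]; [rewrite Z; lra|].
assert (N1 : norm (oreal 1) <= 1) by (rewrite norm_oreal, Rabs_R1; lra).
assert (N2 : norm (oreal (-1)) <= 1) by (rewrite norm_oreal, Rabs_left; lra).
assert (L := diff_coeff_1_le f a Ha Ea Hd ounit_i _ _ _ imag_unit_i N1 N2 (norm_normalize _ Z)).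
cbv beta zeta in L.
replace (diff_coeff a (oreal 1) (oreal (-1)) 1) with (scal 2 (a 1%nat)) in L.
- rewrite oip_scal_l, oip_normalize in L by easy. lra.
- unfold diff_coeff. rewrite !opow_real. simpl pow. generalize (a 1%nat). clear. oct_ring.
Qed.

Lemma norm_f_diff_le (u v w : oct) : norm u <= 1 -> norm v <= 1 -> norm w < 1 ->
  norm (f_diff f u v w) <= norm w * (2 - 2 * (1 - norm (a 1%nat)) * ((1 - norm w) / (1 + norm w))).
Proof.
intros Hu Hv Hw. pose proof norm_coeff_1_le as N1. pose proof (norm_ge_0 (a 1%nat)) as N0.
pose proof (norm_ge_0 w) as W0.
destruct (oct_polar w) as (I & x & HI & E).
set (s := norm w) in *. set (g := f_diff f u v w).
(* For w <> 0 this is w^-1 g(w), and its own direction serves as e. *)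
set (k := scal (/ s) (omul (slice_pt I (cos x) (- sin x)) g)).
assert (K0 : 0 <= (1 - s) / (1 + s) <= 1).
{ split; [apply Rdiv_le_0_compat; lra|]. apply Rmult_le_reg_r with (1 + s); [lra|].
  unfold Rdiv. rewrite Rmult_assoc, Rinv_l; lra. }
assert (R0 : 0 <= 2 - 2 * (1 - norm (a 1%nat)) * ((1 - s) / (1 + s))) by nra.
destruct W0 as [W0|W0].
- assert (Nk : norm k = / s * norm g).
  { unfold k. rewrite onorm_scal, norm_omul, norm_slice_conj, Rabs_pos_eq by (easy || (left; apply Rinv_0_lt_compat; easy)).
    ring. }
  assert (Pk : norm g = s * norm k) by (rewrite Nk; field; lra).
  rewrite Pk. apply Rmult_le_compat_l; [lra|].
  destruct (Req_dec (norm k) 0) as [Z|Z]; [rewrite Z; easy|].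
  assert (L := f_quot_harnack f a Ha Ea Hd I u v _ HI Hu Hv (norm_normalize k Z) s x (conj W0 Hw)).
  cbv beta zeta in L.
  unfold f_quot in L. rewrite <- E in L. fold g in L.
  rewrite <- oip_scal_l in L. fold k in L. rewrite oip_normalize in L by easy.
  assert (B : oip (diff_coeff a u v 1) (scal (/ norm k) k) <= 2 * norm (a 1%nat)).
  { eapply Rle_trans; [apply Rle_abs|]. eapply Rle_trans; [apply oip_le_norm|].
    rewrite norm_normalize, Rmult_1_r by easy. now apply norm_diff_coeff. }
  assert (0 <= (2 * norm (a 1%nat) - oip (diff_coeff a u v 1) (scal (/ norm k) k)) * ((1 - s) / (1 + s)))
    by (apply Rmult_le_pos; lra).
  lra.
(* At w = 0 the bound is 0, and g(0) = b_0 = 0. *)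
- rewrite <- W0, Rmult_0_l. right.
  assert (Z : w = ozero) by (apply oip_eq_0; rewrite <- norm_oip_sqr; fold s; rewrite <- W0; ring).
  assert (T := f_diff_spec f a Ha Ea u v w Hu Hv Hw). fold g in T.
  assert (G : g = ozero).
  { apply oip_ext. intros e. apply (is_series_oip _ _ e) in T. apply is_series_unique in T.
    rewrite <- T, oip_zero_l. apply is_series_unique.
    refine (is_series_ext _ _ _ _ (is_series_single 0 0)). intros n.
    destruct n as [|n]; simpl Nat.eq_dec.
    - rewrite diff_coeff_0, omul_zero_r, oip_zero_l. easy.
    - rewrite Z. change (opow ozero (S n)) with (omul ozero (opow ozero n)).
      replace (omul ozero (opow ozero n)) with ozero by (generalize (opow ozero n); clear; oct_ring).
      replace (omul ozero _) with ozero by (generalize (diff_coeff a u v (S n)); clear; oct_ring).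
      rewrite oip_zero_l. easy. }
  rewrite G, norm_oip, oip_zero_l. apply sqrt_0.
Qed.

(** The bound of [norm_f_diff_le] is largest at |w| = r. The subtracted term measures the distance
    from equality and vanishes only when |a_1| = 1. *)
Lemma regular_diam_le_defect (r : R) : 0 < r < 1 ->
  regular_diam f r <= 2 * r - 2 * r * (1 - norm (a 1%nat)) * ((1 - r) / (1 + r)).
Proof.
intros Hr. apply (regular_diam_le f a Ha Ea r _ Hr). intros u v w Hu Hv Hw.
eapply Rle_trans; [apply norm_f_diff_le; lra|].
pose proof norm_coeff_1_le as N1. pose proof (norm_ge_0 (a 1%nat)) as N0.
pose proof (norm_ge_0 w) as W0.
set (A := norm (a 1%nat)) in *. set (s := norm w) in *.
assert (K : (1 - r) / (1 + r) <= (1 - s) / (1 + s)).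
{ apply Rmult_le_reg_r with ((1 + r) * (1 + s)); [nra|].
  replace ((1 - r) / (1 + r) * ((1 + r) * (1 + s))) with ((1 - r) * (1 + s)) by (field; lra).
  replace ((1 - s) / (1 + s) * ((1 + r) * (1 + s))) with ((1 - s) * (1 + r)) by (field; lra). nra. }
assert (K1 : (1 - r) / (1 + r) <= 1).
{ apply Rmult_le_reg_r with (1 + r); [lra|]. unfold Rdiv. rewrite Rmult_assoc, Rinv_l; lra. }
assert (K2 : 0 <= (1 - r) / (1 + r)) by (apply Rdiv_le_0_compat; lra).
set (kr := (1 - r) / (1 + r)) in *. set (ks := (1 - s) / (1 + s)) in *.
assert (H1 : (1 - A) * kr <= (1 - A) * ks) by (apply Rmult_le_compat_l; lra).
assert (H2 : (1 - A) * kr <= 1) by nra.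
assert (H3 : s * (2 - 2 * (1 - A) * ks) <= s * (2 - 2 * ((1 - A) * kr))) by (apply Rmult_le_compat_l; lra).
assert (H4 : s * (2 - 2 * ((1 - A) * kr)) <= r * (2 - 2 * ((1 - A) * kr))) by (apply Rmult_le_compat_r; lra).
lra.
Qed.

(** * The extremal case |a_1| = 1 *)

Section Extremal.

Hypothesis H1 : norm (a 1%nat) = 1.

(* The two points are [exp (I al)] and [- exp (- I al)]. *)
Lemma diff_coeff_arc_le (I : oct) (al : R) (n : nat) : imag_unit I ->
  let b := diff_coeff a (slice_pt I (cos al) (sin al)) (slice_pt I (- cos al) (sin al)) in
  Rabs (oip (b (S (S n))) (a 1%nat)) <= 4 * (1 - cos al) /\
  Rabs (oip (omul I (b (S (S n)))) (a 1%nat)) <= 4 * (1 - cos al).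
Proof.
intros HI b.
assert (N : forall c s, c * c + s * s = 1 -> norm (slice_pt I c s) <= 1).
{ intros c s E. rewrite norm_oip, oip_slice_pt by easy.
  replace (c ^ 2 + s ^ 2) with 1 by (rewrite <- E; ring). rewrite sqrt_1. lra. }
assert (E := sin2_cos2 al). unfold Rsqr in E.
assert (L := diff_coeff_abs_le f a Ha Ea Hd I _ _ _ HI (N (cos al) (sin al) ltac:(lra))
  (N (- cos al) (sin al) ltac:(lra)) H1 (S n) ltac:(lia)).
cbv beta zeta in L.
fold b in L.
(* Here b_1 = (u - v) a_1 = 2 cos(al) a_1, so the margin 2 - <b_1, a_1> is of second order in al. *)
assert (B1 : oip (b 1%nat) (a 1%nat) = 2 * cos al).
{ unfold b, diff_coeff. simpl opow.
  transitivity (2 * cos al * oip (a 1%nat) (a 1%nat)).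
  - generalize (cos al) (sin al) (a 1%nat). clear. oct_ring.
  - rewrite <- norm_oip_sqr, H1. ring. }
rewrite B1 in L. replace (4 * (1 - cos al)) with (2 * (2 - 2 * cos al)) by ring. exact L.
Qed.

(** Since - exp(-I al) = exp(I (pi - al)), the difference u^n - v^n keeps only the cosine for odd n
    and only the sine for even n. *)
Lemma diff_coeff_arc (I : oct) (al : R) (n : nat) : imag_unit I ->
  diff_coeff a (slice_pt I (cos al) (sin al)) (slice_pt I (- cos al) (sin al)) n =
  omul (slice_pt I ((1 - (-1) ^ n) * cos (INR n * al)) ((1 + (-1) ^ n) * sin (INR n * al))) (a n).
Proof.
intros HI. unfold diff_coeff.
assert (P : forall y, opow (slice_pt I (cos y) (sin y)) n = slice_pt I (cos (INR n * y)) (sin (INR n * y))).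
{ intros y. replace (slice_pt I (cos y) (sin y)) with (slice_pt I (1 * cos y) (1 * sin y)) by now rewrite !Rmult_1_l.
  rewrite opow_polar, pow1, !Rmult_1_l by easy. easy. }
replace (slice_pt I (- cos al) (sin al)) with (slice_pt I (cos (PI - al)) (sin (PI - al))).
2: { rewrite cos_minus, sin_minus, cos_PI, sin_PI. f_equal; ring. }
rewrite !P.
destruct (cos_sin_INR_PI n) as [C1 C2].
replace (INR n * (PI - al)) with (INR n * PI - INR n * al) by ring.
rewrite cos_minus, sin_minus, C1, C2.
generalize (cos (INR n * al)) (sin (INR n * al)) ((-1) ^ n) (a n). clear. oct_ring.
Qed.

Lemma coeff_slice_orthogonal (I : oct) (n : nat) : imag_unit I ->
  oip (a (S (S n))) (a 1%nat) = 0 /\ oip (omul I (a (S (S n)))) (a 1%nat) = 0.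
Proof.
intros HI. set (m := S (S n)).
assert (L := fun al => diff_coeff_arc_le I al n HI). cbv zeta in L. fold m in L.
destruct (Nat.Even_or_Odd m) as [[k Ek]|[k Ek]].
(* For even m, b_m = 2 sin(m al) I a_m. The bound on I b_m gives the first claim and the bound on
   b_m the second. *)
- assert (Sg : (-1) ^ m = 1) by (rewrite Ek; apply pow_1_even).
  split; apply (tangent_bound_eq_0 _ m ltac:(unfold m; lia)); intros al.
  + destruct (L al) as [_ L2]. rewrite diff_coeff_arc, Sg in L2 by easy.
    replace (oip _ _) with (- (2 * sin (INR m * al) * oip (a m) (a 1%nat))) in L2.
    * now rewrite Rabs_Ropp in L2.
    * rewrite omul_slice, omul_plus_r, !omul_scal_r, omul_imag_twice by easy.
      rewrite oip_plus_l, !oip_scal_l, oip_opp_l. ring.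
  + destruct (L al) as [L1 _]. rewrite diff_coeff_arc, Sg in L1 by easy.
    rewrite omul_slice, oip_plus_l, !oip_scal_l in L1.
    replace (_ + _) with (2 * sin (INR m * al) * oip (omul I (a m)) (a 1%nat)) in L1 by ring.
    exact L1.
(* For odd m the angle al = 0 is enough: the bounds are 0 and b_m = 2 a_m. *)
- assert (Sg : (-1) ^ m = -1).
  { rewrite Ek, Nat.add_1_r. apply pow_1_odd. }
  destruct (L 0) as [L1 L2]. rewrite diff_coeff_arc, Sg, omul_slice, Rmult_0_r, cos_0, sin_0 in L1, L2 by easy.
  rewrite omul_plus_r, !omul_scal_r, omul_imag_twice in L2 by easy.
  rewrite oip_plus_l, !oip_scal_l in L1, L2. rewrite oip_opp_l in L2.
  split; [apply Rabs_le_between in L1|apply Rabs_le_between in L2]; lra.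
Qed.

(* The orthogonality on every slice says [<c a_n, a_1> = 0] for all octonions [c];
   take [c = a_1 conj(a_n)]. *)
Lemma coeff_eq_0 (n : nat) : a (S (S n)) = ozero.
Proof.
apply oip_eq_0. set (p := a (S (S n))). set (q := a 1%nat).
assert (O : forall c, oip (omul c p) q = 0).
{ intros c. rewrite (slice_pt_slice_unit c), omul_slice, oip_plus_l, !oip_scal_l.
  destruct (coeff_slice_orthogonal (slice_unit c) n (imag_unit_slice_unit c)) as [O1 O2].
  fold p q in O1, O2. rewrite O1, O2. ring. }
specialize (O (omul q (minus (oreal (2 * ore p)) p))).
rewrite omul_conj_mul, oip_scal_l, <- (norm_oip_sqr q) in O. unfold q in O. rewrite H1 in O. lra.
Qed.

End Extremal.

End DiameterTwo.

(** * Affine functions and the equality case *)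

Lemma power_expansion_affine (f : oct -> oct) (p q : oct) :
  (forall w, oball w -> f w = plus p (omul w q)) <->
  power_expansion f (fun n => match n with 0%nat => p | 1%nat => q | _ => ozero end).
Proof.
set (a n := match n with 0%nat => p | 1%nat => q | _ => ozero end).
assert (T : forall w e, is_series (fun n => oip (omul (opow w n) (a n)) e) (oip (plus p (omul w q)) e)).
{ intros w e. rewrite oip_plus_l.
  refine (is_series_ext _ _ _ _ (is_series_plus _ _ _ _ (is_series_single (oip p e) 0)
    (is_series_single (oip (omul w q) e) 1))).
  intros n. transitivity ((if Nat.eq_dec n 0 then oip p e else 0)
    + (if Nat.eq_dec n 1 then oip (omul w q) e else 0)); [easy|].
  destruct n as [|[|n]].
  - change (opow w 0) with (oreal 1). change (a 0%nat) with p.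
    rewrite omul_real_l, oip_scal_l. simpl Nat.eq_dec. cbn iota. real_eq. ring.
  - change (opow w 1) with (omul w (oreal 1)). change (a 1%nat) with q.
    simpl Nat.eq_dec. cbn iota. rewrite Rplus_0_l. f_equal. f_equal. clear. oct_ring.
  - change (a (S (S n))) with ozero. rewrite omul_zero_r, oip_zero_l.
    simpl Nat.eq_dec. cbn iota. real_eq. ring. }
split.
- intros H w Hw. apply is_series_oct. intros e. rewrite (H w Hw). apply T.
- intros H w Hw. apply oip_ext. intros e.
  assert (S1 := is_series_oip _ _ e (H w Hw)). apply is_series_unique in S1.
  rewrite <- S1. apply is_series_unique, T.
Qed.

Theorem theorem1p4 : forall f : oct -> oct,
  slice_regular oball f ->
  is_regular_diam_ball f 2 ->
  (forall r : R, 0 < r < 1 -> regular_diam f r <= 2 * r) /\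
  norm (slice_derive f ozero) <= 1 /\
  (((exists r0 : R, 0 < r0 < 1 /\ regular_diam f r0 = 2 * r0) \/
    norm (slice_derive f ozero) = 1) <->
   (forall w : oct, oball w ->
      f w = plus (f ozero) (omul w (slice_derive f ozero)))).
Proof.
intros f Hf Hd.
assert (Ha := coeff_spec f Hf). rewrite (slice_derive_0 f Hf).
set (a := coeff f) in *.
assert (N1 := norm_coeff_1_le f a Ha eq_refl Hd).
assert (D := regular_diam_le_defect f a Ha eq_refl Hd).
assert (K : forall r, 0 < r < 1 -> 0 < (1 - r) / (1 + r)) by (intros; apply Rdiv_lt_0_compat; lra).
split; [|split; [easy|split]].
- intros r Hr. eapply Rle_trans; [apply D, Hr|].
  specialize (K r Hr).
  assert (0 <= 2 * r * (1 - norm (a 1%nat)) * ((1 - r) / (1 + r))); [|lra].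
  apply Rmult_le_pos; [apply Rmult_le_pos|]; lra.
- intros H.
  assert (H1 : norm (a 1%nat) = 1).
  (* If |a_1| < 1, the defect term is positive for every r, which excludes equality in (a). *)
  { destruct H as [(r & Hr & E)|E]; [|easy].
    specialize (D r Hr). specialize (K r Hr). apply Rle_antisym; [easy|].
    apply Rnot_lt_le. intros N.
    assert (0 < 2 * r * (1 - norm (a 1%nat)) * ((1 - r) / (1 + r))); [|lra].
    apply Rmult_lt_0_compat; [apply Rmult_lt_0_compat|]; lra. }
  rewrite (power_expansion_0 f a Ha). apply power_expansion_affine.
  intros w Hw. refine (is_series_ext _ _ _ _ (Ha w Hw)).
  intros [|[|n]]; [easy|easy|].
  now rewrite (coeff_eq_0 f a Ha eq_refl Hd H1).
- intros H. right. apply Rle_antisym; [easy|].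
  apply power_expansion_affine in H.
  assert (C : forall n, a n = match n with 0%nat => f ozero | 1%nat => a 1%nat | _ => ozero end)
    by (intros n; exact (power_expansion_unique f _ _ n Ha H)).
  (* For affine f the difference f_u - f_v is w b_1, of norm at most 2 |a_1|. As the diameters tend
     to 2, this forces |a_1| >= 1. *)
  assert (B : forall r, 0 < r < 1 -> regular_diam f r <= 2 * norm (a 1%nat)).
  { intros r Hr. apply (regular_diam_le f a Ha eq_refl r _ Hr). intros u v w Hu Hv Hw.
    assert (E : f_diff f u v w = omul w (diff_coeff a u v 1)).
    { apply oip_ext. intros e.
      assert (T := is_series_oip _ _ e (f_diff_spec f a Ha eq_refl u v w Hu Hv ltac:(lra))).
      apply is_series_unique in T. rewrite <- T. apply is_series_unique.
      refine (is_series_ext _ _ _ _ (is_series_single _ 1)).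
      intros [|[|n]]; simpl Nat.eq_dec; cbn iota.
      - rewrite diff_coeff_0, omul_zero_r, oip_zero_l. easy.
      - change (opow w 1) with (omul w (oreal 1)). f_equal. generalize (diff_coeff a u v 1). clear. oct_ring.
      - unfold diff_coeff. rewrite (C (S (S n))), !omul_zero_r.
        replace (minus ozero ozero) with ozero by oct_ring.
        rewrite omul_zero_r, oip_zero_l. easy. }
    rewrite E, norm_omul.
    assert (X := norm_diff_coeff a u v 1 Hu Hv).
    pose proof (norm_ge_0 (diff_coeff a u v 1)). pose proof (norm_ge_0 w). nra. }
  apply Rnot_lt_le. intros N.
  destruct (regular_diam_near f 2 Hd (2 - 2 * norm (a 1%nat)) 0 ltac:(lra) ltac:(lra)) as (r & _ & Hr & R).
  specialize (B r Hr). apply Rabs_lt_between in R. lra.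
Qed.
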